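(* Let $\xi,\xi_1,\xi_2,\ldots$ be independent identically distributed real random variables with finite mean ${\bf E}\xi>0$ and common distribution $F\in\mathcal S^*$. Let $\tau$ be a counting random variable with ${\bf E}\tau<\infty$, independent of the sequence $\{\xi_n\}$, and suppose that $$ \overline F(x)=O({\bf P}\{\tau>x\})\quad\text{as }x\to\infty . $$ If the distribution of $\tau$ is intermediate regularly varying, then $$ {\bf P}\{S_\tau>x\}\sim{\bf P}\{M_\tau>x\}\sim{\bf E}\tau\,\overline F(x)+{\bf P}\{\tau>x/{\bf E}\xi\}\quad\text{as }x\to\infty . $$
   Context: $\overline F(x)={\bf P}\{\xi>x\}$, and $F$ is right-unbounded: $\overline F(x)>0$ for all $x$. $S_0=0$, $S_n=\xi_1+\cdots+\xi_n$, $M_n=\max_{0\le i\le n}S_i$. A counting random variable is a random variable with values in $\{0,1,2,\ldots\}$; $S_\tau$ and $M_\tau$ are $S_n$ and $M_n$ evaluated at the random index $n=\tau$. The notation $f(x)\sim g(x)$ means $f(x)/g(x)\to1$. A distribution $F$ on ${\bf R}$ with finite mean (and $\overline F(x)>0$ for all $x$) belongs to the class $\mathcal S^*$ if $\int_0^x\overline F(x-y)\overline F(y)\,dy\sim 2a\,\overline F(x)$ as $x\to\infty$, where $a=\int_0^\infty\overline F(y)\,dy$. A distribution $G$ with tail $\overline G(x)=G((x,\infty))>0$ for all $x$ is intermediate regularly varying (at infinity) if $\lim_{\varepsilon\downarrow0}\limsup_{x\to\infty}\overline G((1-\varepsilon)x)/\overline G(x)=1$. *)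

(* Defs.v *)
From HB Require Import structures.
From mathcomp Require Import all_boot all_order all_algebra.
From mathcomp Require Import finmap.
From mathcomp Require Import all_classical all_reals all_analysis.

Set Implicit Arguments.
Unset Strict Implicit.
Unset Printing Implicit Defensive.

Import Order.TTheory GRing.Theory Num.Theory.
Import numFieldNormedType.Exports.

Local Open Scope classical_set_scope.
Local Open Scope ring_scope.

Definition tail (R : realType) (G : probability R R) (x : R) : R :=
  fine (G `]x, +oo[%classic).

(* Since r / 0 = 0 in a field, the limit 1 forces g to be eventually nonzero. *)
Definition asymp_equiv (R : realType) (f g : R -> R) : Prop :=
  f x / g x @[x --> +oo] --> (1 : R).

(* pinfty_nbhs packaged as a filter_on, as required by the =O_ notation. *)
Definition pinfty_filter (R : realType) : filter_on R :=
  FilterType (pinfty_nbhs R) _.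

Definition class_Sstar (R : realType) (F : probability R R) : Prop :=
  let a := \int[lebesgue_measure]_(y in `[0, +oo[) tail F y in
  [/\ F.-integrable [set: R] (EFin : R -> \bar R),
      forall x : R, 0 < tail F x &
      asymp_equiv
        (fun x => \int[lebesgue_measure]_(y in `[0, x]) (tail F (x - y) * tail F y))
        (fun x => 2 * a * tail F x)].

Definition intermediate_regularly_varying (R : realType)
    (G : probability R R) : Prop :=
  (forall x : R, 0 < tail G x) /\
  (limf_esup (fun x : R => (tail G ((1 - e) * x) / tail G x)%:E) (pinfty_nbhs R)
     @[e --> 0^'+] --> 1%E).

Definition mutually_independent d (T : measurableType d) (R : realType)
    (P : probability T R) (I : choiceType) (X : I -> {RV P >-> R}) : Prop :=
  forall (J : {fset I}) (B : I -> set R),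
    (forall i, i \in J -> measurable (B i)) ->
    P (\bigcap_(i in [set` J]) (X i @^-1` B i)) =
    (\prod_(i <- J) P (X i @^-1` B i))%E.

Definition sigma_of_sequence d (T : measurableType d) (R : realType)
    (P : probability T R) (X : nat -> {RV P >-> R}) : set_system T :=
  <<s \bigcup_n preimage_set_system [set: T] (X n) measurable >>.

(* Every subset of nat is measurable, so sigma(tau) = {tau @^-1` K | K}. *)
Definition independent_of_sequence d (T : measurableType d) (R : realType)
    (P : probability T R) (tau : {RV P >-> nat})
    (X : nat -> {RV P >-> R}) : Prop :=
  forall (K : set nat) (A : set T), sigma_of_sequence X A ->
    P ((tau @^-1` K) `&` A) = (P (tau @^-1` K) * P A)%E.

(* Measures are compared on measurable sets only: P is unconstrained elsewhere. *)
Definition same_law d (T : measurableType d) (R : realType)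
    (P : probability T R) (X Y : {RV P >-> R}) : Prop :=
  forall B : set R, measurable B -> distribution P X B = distribution P Y B.

(* The sequence xi_1, xi_2, ... is represented by X 0, X 1, ... *)
Definition partial_sum d (T : measurableType d) (R : realType)
    (P : probability T R) (X : nat -> {RV P >-> R}) (n : nat) (w : T) : R :=
  \sum_(i < n) X i w.

Definition partial_max d (T : measurableType d) (R : realType)
    (P : probability T R) (X : nat -> {RV P >-> R}) (n : nat) (w : T) : R :=
  \big[Num.max/partial_sum X 0 w]_(0 <= i < n.+1) partial_sum X i w.

(* The embedding of nat into R, as a measurable function, so that a counting
   random variable tau has the real-valued version nat_to_real R \o tau. *)
Definition nat_to_real (R : realType) (n : nat) : R := n%:R.

Lemma measurable_nat_to_real (R : realType) :
  measurable_fun [set: nat] (@nat_to_real R).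
Proof. by []. Qed.

HB.instance Definition _ (R : realType) :=
  isMeasurableFun.Build _ _ _ _ (@nat_to_real R) (@measurable_nat_to_real R).

(* Main.v *)
Require Import Defs.
From HB Require Import structures.
From mathcomp Require Import all_boot all_order all_algebra.
From mathcomp Require Import finmap.
From mathcomp Require Import all_classical all_reals all_analysis.
From mathcomp Require Import measurable_realfun random_variable.
From mathcomp Require Import ring lra.

Set Implicit Arguments.
Unset Strict Implicit.
Unset Printing Implicit Defensive.

Import Order.TTheory GRing.Theory Num.Theory.
Import numFieldNormedType.Exports.

Local Open Scope classical_set_scope.
Local Open Scope ring_scope.

(** Let F be the law of a step, m its mean, S_n the walk, M_n its running
    maximum, and write Fb and Gb for the tails of F and of tau.  The proof
    conditions on tau and splits its range at three scales.

    For a bounded number n of steps, S_n exceeds a high level x essentially only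
    when one single step does: P(S_n > x) = n Fb(x) + o(Gb(x))
    ([sum_tail_upper], [sum_tail_lower]).  Membership of F in the class S* enters
    through long-tailedness, Fb(x - h) ~ Fb(x) ([Sstar_long_tailed]).  Summed
    against the law of tau this produces the term E(tau) Fb(x).

    For n up to t x/m with t < 1, P(S_n > x) <= B n Gb(x) with B independent of
    n and x ([large_index_upper]).  As E(tau) is finite, the indices between a
    large constant and t x/m contribute an arbitrarily small multiple of Gb(x),
    and Gb(x) is at most a constant times Gb(x/m).

    For n beyond x/(m t), P(S_n > x) tends to 1 by the law of large numbers
    ([sum_tail_law_of_large_numbers]), which produces the term Gb(x/m).
    Intermediate regular variation says that the indices between t x/m and
    x/(m t) carry a negligible share of Gb(x/m) when t is close to 1.

    The uniform bound for moderate n comes from a walk with negative drift,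
    S_n - n c with c slightly above m.  Let W_n solve the Lindley recursion
    W_{n+1} = max(0, W_n + Y_n) for its steps Y_n, and let p_n be the tail of
    W_n; then p_n dominates the tail of the walk.  Splitting at a level crossing
    gives p_n(3x) <= n Fb(x) + p_n(x)^2 ([wait_split]).  Once p_n is small far
    out, uniformly in n, this inequality iterates to p_n(x) <= B n Gb(x), because
    Fb = O(Gb) and Gb(x) <= A Gb(3x) ([wait_linear_bound]).  Uniform smallness
    follows from two facts: the limit of p_n is either identically 1 or tends to
    0 at infinity ([wait_sup_defect]), and the former would make the mean of W_n
    decrease forever ([wait_sup_lt1]).  The same smallness, applied to the walk
    with steps c - X for c below m, is the law of large numbers used above.

    The maximum is reduced to the sum by Ottaviani's inequality
    P(M_n > x) inf_k P(S_k > -A) <= P(S_n > x - A) ([ottaviani]), where the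
    infimum is close to 1 for large A since the drift m is positive.  So the upper
    bound is proved for M_tau and the lower bound for S_tau, and S_tau <= M_tau
    closes the argument. *)

(** * Integrals of bounded functions and real-valued probabilities *)

Section BoundedIntegrals.
Context d (T : measurableType d) (R : realType) (P : probability T R).
Implicit Types f g : T -> R.

(** Closed under the operations used below and integrable for every
    probability, so the integral rules need no integrability hypotheses. *)
Definition bounded_measurable f :=
  measurable_fun [set: T] f /\ exists M, forall y, `|f y| <= M.

Lemma bounded_measurable_integrable f :
  bounded_measurable f -> P.-integrable [set: T] (EFin \o f).
Proof.
move=> [mf [M fM]].
apply: (@le_integrable _ _ _ P setT _ _ (cst M%:E)) => //.
- exact/measurable_EFinP.
- move=> y _ /=; rewrite lee_fin (le_trans (fM y))// ler_norm//.
- exact: finite_measure_integrable_cst.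
Qed.

Lemma bounded_measurable01 f : measurable_fun [set: T] f ->
  (forall y, 0 <= f y <= 1) -> bounded_measurable f.
Proof.
move=> mf f01; split=> //; exists 1 => y.
by have /andP[f0 f1] := f01 y; rewrite ger0_norm.
Qed.

Lemma bounded_measurableD f g : bounded_measurable f -> bounded_measurable g ->
  bounded_measurable (fun y => f y + g y).
Proof.
move=> [mf [M fM]] [mg [N gN]]; split; first exact: measurable_funD.
by exists (M + N) => y; rewrite (le_trans (ler_normD _ _))// lerD.
Qed.

Lemma bounded_measurableZ f a : bounded_measurable f ->
  bounded_measurable (fun y => a * f y).
Proof.
move=> [mf [M fM]]; split; first exact: measurable_funM.
by exists (`|a| * M) => y; rewrite normrM ler_wpM2l.
Qed.

Lemma bounded_measurable_cst a : bounded_measurable (cst a).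
Proof. by split; [exact: measurable_cst | exists `|a|]. Qed.

Lemma Rint_le f g : bounded_measurable f -> bounded_measurable g ->
  (forall y, f y <= g y) -> \int[P]_y f y <= \int[P]_y g y.
Proof.
by move=> bf bg fg; apply: le_Rintegral => // ; exact: bounded_measurable_integrable.
Qed.

Lemma RintD f g : bounded_measurable f -> bounded_measurable g ->
  \int[P]_y (f y + g y) = \int[P]_y f y + \int[P]_y g y.
Proof.
by move=> bf bg; apply: RintegralD => //; exact: bounded_measurable_integrable.
Qed.

Lemma RintZ f a : bounded_measurable f ->
  \int[P]_y (a * f y) = a * \int[P]_y f y.
Proof.
by move=> bf; apply: RintegralZl => //; exact: bounded_measurable_integrable.
Qed.

Lemma Rint_cst a : \int[P]_y a = a.
Proof. by rewrite Rintegral_cst// [X in fine X]probability_setT /= mulr1. Qed.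

Lemma Rint_indic (A : set T) : measurable A ->
  \int[P]_y (\1_A y) = fine (P A).
Proof. by move=> mA; rewrite /Rintegral integral_indic// setIT. Qed.

Lemma bounded_measurable_indic (A : set T) : measurable A ->
  bounded_measurable (\1_A : T -> R).
Proof.
move=> mA; apply: bounded_measurable01; first exact: measurable_indic.
by move=> y; rewrite indicE; case: (_ \in _); rewrite ?lexx ?ler01.
Qed.

End BoundedIntegrals.

Section RealProbability.
Context d (T : measurableType d) (R : realType) (P : probability T R).
Implicit Types A B : set T.

(** Real-valued, so that estimates reduce to linear arithmetic over R. *)
Definition pr A : R := fine (P A).

Lemma prE A : measurable A -> P A = (pr A)%:E.
Proof. by move=> mA; rewrite /pr fineK// fin_num_measure. Qed.

Lemma pr_ge0 A : 0 <= pr A.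
Proof. by rewrite /pr fine_ge0. Qed.

Lemma pr_le1 A : measurable A -> pr A <= 1.
Proof. by move=> mA; rewrite -lee_fin -prE// probability_le1. Qed.

Lemma prT : pr setT = 1.
Proof. by rewrite /pr probability_setT. Qed.

Lemma pr_le A B : measurable A -> measurable B -> A `<=` B -> pr A <= pr B.
Proof.
by move=> mA mB AB; rewrite -lee_fin -!prE// le_measure// inE.
Qed.

Lemma prU A B : measurable A -> measurable B -> [disjoint A & B] ->
  pr (A `|` B) = pr A + pr B.
Proof.
move=> mA mB; rewrite disj_set2E => /eqP AB; apply: EFin_inj.
by rewrite EFinD -!prE//; [exact: measureU|exact: measurableU].
Qed.

Lemma prC A : measurable A -> pr (~` A) = 1 - pr A.
Proof.
move=> mA; apply: EFin_inj.
by rewrite EFinB -!prE// ?probability_setC//; exact: measurableC.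
Qed.

End RealProbability.

(** * Tails of distributions *)

Section Tails.
Context (R : realType) (Q : probability R R).

Lemma tail_ge0 x : 0 <= tail Q x.
Proof. exact: pr_ge0. Qed.

Lemma tail_le1 x : tail Q x <= 1.
Proof. exact: pr_le1. Qed.

Lemma tail_noninc x y : x <= y -> tail Q y <= tail Q x.
Proof. by move=> xy; apply: pr_le => // z /=; rewrite !in_itv/= !andbT; exact: le_lt_trans. Qed.

(* As a random variable on (R, Q), the identity has law Q, so the limits of the
   complementary distribution function apply to the tail of Q. *)
Let idR : R -> R := idfun.

#[local] HB.instance Definition _ := @isMeasurableFun.Build _ _ R R idR
  (@measurable_id _ _ setT).

Lemma tail_cvg0 e : 0 < e -> \forall x \near +oo, tail Q x < e.
Proof.
move=> e0.
have /fine_cvgP[_ /cvgrPdist_lt/(_ _ e0)] := cvg_ccdfy0 (idR : {RV Q >-> R}).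
apply: filterS => x /=; rewrite sub0r normrN.
exact: le_lt_trans (ler_norm _).
Qed.

Lemma tail_cvg1 e : 0 < e -> \forall x \near +oo, 1 - e < tail Q (- x).
Proof.
move=> e0.
have /fine_cvgP[_ /cvgrPdist_lt/(_ _ e0)] := cvg_ccdfNy1 (idR : {RV Q >-> R}).
case=> M [Mr H]; exists (- M); split; first by rewrite realN.
move=> x Mx; have /= : `|1 - tail Q (- x)| < e by apply: H => /=; lra.
by move=> /(le_lt_trans (ler_norm _)) ?; lra.
Qed.

(** Integrals of these indicators are tails ([Rint_over]): bounding an integrand
    by a combination of them bounds the integral by a combination of tails. *)
Definition over (t y : R) : R := \1_(`]t, +oo[%classic) y.

Lemma overE t y : over t y = if t < y then 1 else 0.
Proof.
rewrite /over indicE; have -> : (y \in `]t, +oo[%classic) = (t < y).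
  by apply/idP/idP; rewrite inE /= in_itv/= andbT.
by case: ifP.
Qed.

Lemma Rint_over t : \int[Q]_y over t y = tail Q t.
Proof. exact: Rint_indic. Qed.

Lemma bounded_over t : bounded_measurable (over t).
Proof. exact: bounded_measurable_indic. Qed.

(** Makes a tail at x - y, as a function of the step y, integrable. *)
Lemma bounded_reflect (f : R -> R) (x : R) : (forall s t, s <= t -> f t <= f s) ->
  (forall y, 0 <= f y <= 1) -> bounded_measurable (fun y : R => f (x - y)).
Proof.
move=> fni f01; apply: bounded_measurable01 => //.
by apply: nondecreasing_measurable => // s t st; apply: fni; lra.
Qed.

Lemma dominating_constant_ge0 (g : R -> R) C : (forall x, 0 < g x) ->
  (\forall x \near +oo, tail Q x <= C * g x) -> 0 <= C.
Proof.
move=> g0 tC; near (pinfty_nbhs R) => x.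
rewrite -(pmulr_lge0 _ (g0 x)); apply: le_trans (tail_ge0 x) _.
by near: x.
Unshelve. all: by end_near. Qed.

End Tails.

(** * The Lindley recursion *)

Section LindleyTail.
Context (R : realType) (Q : probability R R).

(** Tail of W_n, where W_0 = 0 and W_{n+1} = max(0, W_n + Y_n) with independent
    Y_n of law Q: the waiting time of the n-th customer of a single-server queue
    ([lindley_tail]).  Taking the recursion on tails as the definition lets the
    bounds below be proved by induction on n, without sample paths. *)
Fixpoint wait (n : nat) (x : R) : R :=
  if x < 0 then 1 else
  if n is m.+1 then \int[Q]_y wait m (x - y) else 0.

Lemma wait_neg n x : x < 0 -> wait n x = 1.
Proof. by case: n => [|n] /= ->. Qed.

Lemma wait0 x : 0 <= x -> wait 0 x = 0.
Proof. by rewrite /= leNgt => /negbTE ->. Qed.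

Lemma waitS n x : 0 <= x -> wait n.+1 x = \int[Q]_y wait n (x - y).
Proof. by rewrite /= leNgt => /negbTE ->. Qed.

Lemma wait_01_noninc n : (forall x, 0 <= wait n x <= 1) /\
  (forall x y, x <= y -> wait n y <= wait n x).
Proof.
elim: n => [|n [IH01 IHni]].
  split=> [x|x y xy] /=; first by case: ifP; rewrite ?lexx ?ler01.
  by case: ltP => [y0|y0]; [rewrite (le_lt_trans xy y0)|case: ifP].
have b (x : R) : bounded_measurable (fun y : R => wait n (x - y)) by exact: bounded_reflect.
have H (x : R) : 0 <= \int[Q]_y wait n (x - y) <= 1.
  apply/andP; split; first by apply: Rintegral_ge0 => y _; have /andP[] := IH01 (x - y).
  rewrite -[leRHS](Rint_cst Q); apply: Rint_le => //; first exact: bounded_measurable_cst.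
  by move=> y; have /andP[] := IH01 (x - y).
split=> [x|x y xy] /=; first by case: ifP => // _; rewrite lexx ler01.
case: ltP => y0; first by rewrite (le_lt_trans xy y0).
case: ltP => x0; first by have /andP[] := H y.
by apply: Rint_le => // z; apply: IHni; lra.
Qed.

Lemma wait_ge0 n x : 0 <= wait n x.
Proof. by have [/(_ x) /andP[]] := wait_01_noninc n. Qed.

Lemma wait_le1 n x : wait n x <= 1.
Proof. by have [/(_ x) /andP[]] := wait_01_noninc n. Qed.

Lemma wait_noninc n x y : x <= y -> wait n y <= wait n x.
Proof. by have [_] := wait_01_noninc n; apply. Qed.

Lemma bounded_wait n x : bounded_measurable (fun y : R => wait n (x - y)).
Proof.
apply: bounded_reflect; first exact: wait_noninc.
by move=> y; rewrite wait_ge0 wait_le1.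
Qed.

Lemma wait_leS n x : wait n x <= wait n.+1 x.
Proof.
elim: n x => [|n IH] x; case: (ltP x 0) => x0; try by rewrite !(wait_neg _ x0).
  by rewrite wait0// wait_ge0.
rewrite !waitS//; apply: Rint_le; [exact: bounded_wait..|].
by move=> y; exact: IH.
Qed.

Lemma wait_nd x : nondecreasing_seq (wait ^~ x).
Proof. by apply/nondecreasing_seqP => n; exact: wait_leS. Qed.

(** W_n has the law of the maximum of the walk over n steps, for which this is
    the split at the first passage above u: either one of the n steps exceeds h,
    or the overshoot is at most h and the walk still has to climb by z.  Starting
    the range of u at - h instead of 0 is what makes the induction close: a step
    y <= u + h moves u to u - y >= - h. *)
Lemma wait_split n u z h : 0 <= h -> 0 <= z -> - h <= u ->
  wait n (u + z + h) <= n%:R * tail Q h + wait n u * wait n z.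
Proof.
move=> h0 z0; elim: n u => [|n IH] u uh.
  rewrite mul0r add0r; case: (ltP u 0) => u0.
    by rewrite (wait_neg _ u0) mul1r wait_noninc//; lra.
  by rewrite [leLHS]wait0 ?mulr_ge0 ?wait_ge0//; lra.
have ht : 0 <= n.+1%:R * tail Q h by rewrite mulr_ge0// tail_ge0.
case: (ltP u 0) => u0.
  rewrite (wait_neg _ u0) mul1r ler_wpDl// wait_noninc//; lra.
rewrite waitS; last by lra.
rewrite [X in _ + X * _]waitS//.
pose g (y : R) := n%:R * tail Q h + wait n z * wait n (u - y) + over (u + h) y.
have bg1 : bounded_measurable (fun y : R => n%:R * tail Q h + wait n z * wait n (u - y)).
  apply: bounded_measurableD; first exact: bounded_measurable_cst.
  by apply: bounded_measurableZ; exact: bounded_wait.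
apply: (@le_trans _ _ (\int[Q]_y g y)).
  apply: Rint_le; first exact: bounded_wait.
    by apply: bounded_measurableD => //; exact: bounded_over.
  move=> y; rewrite /g overE; case: ltP => hy.
    rewrite (le_trans (wait_le1 _ _))// lerDr addr_ge0// ?mulr_ge0 ?wait_ge0 ?tail_ge0//.
  rewrite addr0; have -> : u + z + h - y = (u - y) + z + h by ring.
  by rewrite [X in _ <= _ + X]mulrC; apply: IH; lra.
rewrite RintD//; last exact: bounded_over.
rewrite RintD//;
  [|exact: bounded_measurable_cst|by apply: bounded_measurableZ; exact: bounded_wait].
rewrite Rint_cst RintZ; last exact: bounded_wait.
rewrite Rint_over -waitS//.
have t1 : tail Q (u + h) <= tail Q h by apply: tail_noninc; lra.
have w1 : wait n z * wait n.+1 u <= wait n.+1 u * wait n.+1 z.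
  by rewrite mulrC ler_wpM2l ?wait_ge0// wait_leS.
by rewrite -natr1 mulrDl mul1r; lra.
Qed.

Definition wait_sup (x : R) : R := sup (range (wait ^~ x)).

Lemma has_sup_wait x : has_sup (range (wait ^~ x)).
Proof.
by split; [exists (wait 0 x), 0%N|exists 1 => _ [n _ <-]; exact: wait_le1].
Qed.

Lemma wait_le_sup n x : wait n x <= wait_sup x.
Proof. by apply: ub_le_sup; [case: (has_sup_wait x)|exists n]. Qed.

Lemma wait_sup_le x c : (forall n, wait n x <= c) -> wait_sup x <= c.
Proof. by move=> H; apply: ge_sup; [case: (has_sup_wait x)|move=> _ [n _ <-]]. Qed.

Lemma wait_sup_ge0 x : 0 <= wait_sup x.
Proof. exact: le_trans (wait_ge0 0 x) (wait_le_sup 0 x). Qed.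

Lemma wait_sup_le1 x : wait_sup x <= 1.
Proof. by apply: wait_sup_le => n; exact: wait_le1. Qed.

Lemma wait_sup_noninc x y : x <= y -> wait_sup y <= wait_sup x.
Proof.
by move=> xy; apply: wait_sup_le => n; exact: le_trans (wait_noninc n xy) (wait_le_sup _ _).
Qed.

Lemma wait_sup_neg x : x < 0 -> wait_sup x = 1.
Proof.
move=> x0; apply/eqP; rewrite eq_le wait_sup_le1/=.
by rewrite -(wait_neg 0 x0) wait_le_sup.
Qed.

Lemma bounded_wait_sup x : bounded_measurable (fun y : R => wait_sup (x - y)).
Proof.
apply: bounded_reflect; first exact: wait_sup_noninc.
by move=> y; rewrite wait_sup_ge0 wait_sup_le1.
Qed.

(** Monotone convergence in the recursion. *)
Lemma wait_sup_superharmonic x : 0 <= x -> \int[Q]_y wait_sup (x - y) <= wait_sup x.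
Proof.
move=> x0.
have cv (y : R) : (wait n y)%:E @[n --> \oo] --> (wait_sup y)%:E.
  apply: cvg_EFin; first by near=> n.
  by apply: nondecreasing_cvgn; [exact: wait_nd|case: (has_sup_wait y)].
have mw n : measurable_fun [set: R] (fun y : R => (wait n (x - y))%:E).
  by apply/measurable_EFinP; have [] := bounded_wait n x.
have H := @cvg_monotone_convergence _ _ _ Q _ measurableT
   (fun n y => (wait n (x - y))%:E) mw
   (fun n y _ => wait_ge0 n (x - y)) (fun y _ m n mn => wait_nd (x - y) mn).
have -> : \int[Q]_y wait_sup (x - y) =
    fine (\int[Q]_y limn (fun n => (wait n (x - y))%:E)).
  by rewrite /Rintegral; congr fine; apply: eq_integral => y _; rewrite (cvg_lim _ (cv (x - y))).
have : (\int[Q]_y limn (fun n => (wait n (x - y))%:E) <= (wait_sup x)%:E)%E.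
  rewrite -(cvg_lim _ H)//; apply: lime_le; first by apply/cvg_ex; eexists; exact: H.
  near=> n; rewrite -[leLHS]fineK; last first.
    by apply: integrable_fin_num => //; apply: bounded_measurable_integrable; exact: bounded_wait.
  by rewrite lee_fin -[fine _](waitS n x0) wait_le_sup.
move=> H1; rewrite -lee_fin fineK//.
apply/fin_numPlt; rewrite (le_lt_trans H1 (ltry _)) andbT (@lt_le_trans _ _ 0%E)//.
apply: integral_ge0 => y _; apply: lime_ge; first by apply/cvg_ex; eexists; exact: cv.
by near=> n; rewrite lee_fin wait_ge0.
Unshelve. all: by end_near. Qed.

(** Zero-one alternative for the limiting waiting time.  If wait_sup >= L > 0
    everywhere, then (wait_sup - L) / (1 - L) is again 1 on negative
    numbers and superharmonic on the others, so by induction it dominates every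
    wait n, hence wait_sup itself.  This leaves wait_sup = 1. *)
Lemma wait_sup_defect L : 0 < L -> (forall x, L <= wait_sup x) ->
  forall x, wait_sup x = 1.
Proof.
move=> L0 HL x; apply/eqP; rewrite eq_le wait_sup_le1/= leNgt; apply/negP => x1.
have L1 : L < 1 by exact: le_lt_trans (HL x) x1.
have dL : 0 < 1 - L by lra.
have key n y : (1 - L) * wait n y <= wait_sup y - L.
  elim: n y => [|n IH] y; case: (ltP y 0) => y0;
    try by rewrite (wait_neg _ y0) (wait_sup_neg y0) mulr1.
    by rewrite wait0// mulr0 subr_ge0.
  rewrite waitS// -RintZ; last exact: bounded_wait.
  apply: (@le_trans _ _ (\int[Q]_z (wait_sup (y - z) + - L))).
    apply: Rint_le; first by apply: bounded_measurableZ; exact: bounded_wait.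
      by apply: bounded_measurableD; [exact: bounded_wait_sup|exact: bounded_measurable_cst].
    by move=> z; exact: IH.
  rewrite RintD; [|exact: bounded_wait_sup|exact: bounded_measurable_cst].
  by rewrite Rint_cst lerB// wait_sup_superharmonic.
have : wait_sup x <= (wait_sup x - L) / (1 - L).
  by apply: wait_sup_le => n; rewrite ler_pdivlMr// mulrC.
rewrite ler_pdivlMr// => H; have : L * (1 - wait_sup x) <= 0 by lra.
by rewrite leNgt mulr_gt0//; lra.
Qed.

(** By [wait_sup_defect], a limiting waiting time that is finite with positive
    probability has a tail that vanishes at infinity. *)
Lemma wait_tight : (exists x, wait_sup x < 1) ->
  forall e, 0 < e -> \forall x \near +oo, forall n, wait n x <= e.
Proof.
move=> [x1 hx1] e e0.
have [H|/existsNP[x0 /negP]] := pselect (forall x, e <= wait_sup x).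
  by move: hx1; rewrite (wait_sup_defect e0 H) ltxx.
rewrite -ltNge => hx0; near=> x => n.
rewrite (le_trans (wait_le_sup n x))// (le_trans _ (ltW hx0))//.
apply: wait_sup_noninc; near: x; by apply: nbhs_pinfty_ge; exact: num_real.
Unshelve. all: by end_near. Qed.

(** [wait_split] at u = z = h = x / 3 reads
    wait n x <= n tail Q (x / 3) + wait n (x / 3) ^ 2.
    Far out, tightness bounds one factor of the square by 1 / (2 A), so the
    ratio wait n x / (n g x) is at most a constant plus half its value at x / 3;
    such a ratio stays bounded, uniformly in n. *)
Lemma wait_linear_bound (g : R -> R) A C :
  (exists x, wait_sup x < 1) ->
  (forall x y, x <= y -> g y <= g x) -> (forall x, 0 < g x) ->
  (\forall x \near +oo, g x <= A * g (3 * x)) ->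
  (\forall x \near +oo, tail Q x <= C * g x) ->
  exists B, 0 <= B /\ \forall x \near +oo,
    forall n, (0 < n)%N -> wait n x <= B * n%:R * g x.
Proof.
move=> wQ gni g0 gA tC.
have A0 : 0 < A.
  have [x] : exists x, g x <= A * g (3 * x) by near (pinfty_nbhs R) => x; exists x; near: x.
  by move=> /(lt_le_trans (g0 x)); rewrite pmulr_lgt0.
have iA : 0 < (2 * A)^-1 by rewrite invr_gt0 mulr_gt0.
have [M [_ HM]] : \forall x \near +oo, [/\ 0 < x, g x <= A * g (3 * x),
    tail Q x <= C * g x & forall n, wait n x <= (2 * A)^-1].
  near=> x; split; near: x => //; first by apply: nbhs_pinfty_gt; exact: num_real.
  exact: wait_tight.
pose x0 := M + 1.
have {}HM x : x0 <= x -> [/\ 0 < x, g x <= A * g (3 * x),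
    tail Q x <= C * g x & forall n, wait n x <= (2 * A)^-1].
  by move=> xx; apply: HM; apply: lt_le_trans xx; rewrite ltrDl.
have [x00 _ tC0 _] := HM _ (lexx x0).
have C0 : 0 <= C by rewrite -(pmulr_lge0 _ (g0 x0)) (le_trans _ tC0)// tail_ge0.
(* The first summand covers [x0, 3 x0], where wait n x <= 1 suffices; the second
   absorbs the contribution of the step tail in the recursion. *)
pose B := (g (3 * x0))^-1 + 2 * (A * C).
have B0 : 0 <= B by rewrite addr_ge0 ?invr_ge0 ?mulr_ge0// ltW.
have key k x : x0 <= x -> x <= 3 ^+ k.+1 * x0 ->
    forall n, (0 < n)%N -> wait n x <= B * n%:R * g x.
  elim: k x => [|k IH] x xx xk n n0; have n1 : 1 <= n%:R :> R by rewrite ler1n.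
    rewrite (le_trans (wait_le1 _ _))//.
    have gx : g (3 * x0) <= g x by apply: gni; rewrite expr1 in xk.
    have : 1 <= B * g x.
      rewrite -[leLHS](mulVf (lt0r_neq0 (g0 (3 * x0)))).
      by apply: ler_pM => //; [rewrite invr_ge0 ltW|exact: ltW|rewrite lerDl !mulr_ge0// ltW].
    by move=> /le_trans; apply; rewrite mulrAC ler_peMr// mulr_ge0// ltW.
  (* Beyond 3 x0, the point x / 3 is still at least x0. *)
  have [x3|x3] := leP x (3 * x0).
    by apply: IH => //; rewrite (le_trans x3)// ler_pM2r// exprS ler_peMr// exprn_ege1// ler1n.
  pose y := x / 3.
  have xy : x = 3 * y by rewrite /y; field.
  have yx0 : x0 <= y by rewrite /y ler_pdivlMr// mulrC ltW.
  have [y0 gy ty wy] := HM _ yx0.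
  have yk : y <= 3 ^+ k.+1 * x0.
    by rewrite /y ler_pdivrMr// mulrC mulrA -exprS.
  have := wait_split n (ltW y0) (ltW y0) (_ : - y <= y).
  have -> : y + y + y = x by rewrite xy; ring.
  move=> /(_ _)/le_trans; apply; first by lra.
  have h1 : n%:R * tail Q y <= n%:R * (C * (A * g x)).
    rewrite ler_wpM2l// (le_trans ty)// ler_wpM2l// xy//.
  have h2 : wait n y * wait n y <= (2 * A)^-1 * (B * n%:R * (A * g x)).
    apply: ler_pM; rewrite ?wait_ge0//.
    rewrite (le_trans (IH _ yx0 yk _ n0))// ler_wpM2l// ?mulr_ge0// xy//.
  apply: (le_trans (lerD h1 h2)).
  have -> : (2 * A)^-1 * (B * n%:R * (A * g x)) = 2^-1 * (B * n%:R * g x).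
    by field; rewrite lt0r_neq0.
  have -> : n%:R * (C * (A * g x)) = 2^-1 * (2 * (A * C) * n%:R * g x) by field.
  have : 2 * (A * C) * n%:R * g x <= B * n%:R * g x.
    rewrite ler_pM2r// ler_wpM2r// /B lerDr invr_ge0 ltW//.
  by lra.
exists B; split=> //; exists x0; split; first exact: num_real.
move=> x /ltW xx n n0.
pose k := (Num.truncn (x / x0)).+1.
apply: (key k) => //.
rewrite -ler_pdivrMr// (le_trans (ltW (truncnS_gt _)))//.
rewrite -natrX ler_nat (leq_trans _ (ltnW (ltn_expl _ _)))//.
Unshelve. all: by end_near. Qed.

End LindleyTail.

(** * Independence of the past and the next step *)

Section Past.
Context d (T : measurableType d) (R : realType) (P : probability T R).
Variable X : nat -> {RV P >-> R}.

Definition past_generators n : set_system T :=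
  \bigcup_(i in `I_n) preimage_set_system [set: T] (X i) measurable.

(** Phrased with the measurable type generated by the first n steps, so that the
    closure properties of measurable functions apply to functions of the past. *)
Definition past_measurable n (V : T -> R) :=
  measurable_fun [set: g_sigma_algebraType (past_generators n)]
    (V : g_sigma_algebraType (past_generators n) -> R).

Definition past n : set_system T := <<s past_generators n >>.

Lemma past_measurableX n i : (i < n)%N -> past_measurable n (X i).
Proof.
move=> lin _ B mB; apply: sub_sigma_algebra.
by exists i => //; exists B.
Qed.

Lemma past_generators_sub n m : (n <= m)%N -> past n `<=` past m.
Proof.
move=> nm; apply: sub_smallest2r; first exact: smallest_sigma_algebra.
move=> A [i /= lin H]; exists i => //=.
exact: leq_trans lin nm.
Qed.

Lemma past_measurable_le n m V : (n <= m)%N ->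
  past_measurable n V -> past_measurable m V.
Proof.
by move=> nm mV _ B mB; apply: (past_generators_sub nm); exact: mV.
Qed.

Lemma past_sub_measurable n : past n `<=` measurable.
Proof.
apply: smallest_sub; first exact: sigma_algebra_measurable.
by move=> _ [i _ [B mB <-]]; rewrite setTI; exact: measurable_funPTI.
Qed.

Lemma past_measurable_ambient n V : past_measurable n V -> measurable_fun setT V.
Proof. by move=> mV _ B mB; apply: (@past_sub_measurable n); exact: mV. Qed.

Hypothesis Xindep : mutually_independent X.

(** Dynkin's pi-lambda argument: the sets A satisfying the product rule form a
    Dynkin class, and the intersections of events on single steps, for which the
    rule is mutual independence, are a pi-system generating the past. *)
Lemma past_indep n A B : past n A -> measurable B ->
  P (A `&` X n @^-1` B) = (P A * P (X n @^-1` B))%E.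
Proof.
move=> pA mB.
pose G : set_system T := [set A | exists C : nat -> set R,
  (forall i, measurable (C i)) /\ A = \bigcap_(i in `I_n) (X i @^-1` C i)].
have GI : setI_closed G.
  move=> _ _ [C [mC ->]] [D [mD ->]]; exists (fun i => C i `&` D i).
  split; first by move=> i; exact: measurableI.
  by rewrite -bigcapI; apply: eq_bigcapr => i _; rewrite preimage_setI.
have GP A' : G A' -> measurable A' /\ P (A' `&` X n @^-1` B) = (P A' * P (X n @^-1` B))%E.
  move=> [C [mC ->]].
  pose J := [fset i in iota 0 n]%fset.
  have JE : `I_n = [set` J].
    by apply/seteqP; split=> i /=; rewrite !inE mem_iota add0n leq0n.
  have nJ : n \notin J by rewrite !inE mem_iota add0n ltnn andbF.
  split; first by apply: fin_bigcap_measurable => // i _; exact: measurable_funPTI.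
  pose D i := if i == n then B else C i.
  have mD i : measurable (D i) by rewrite /D; case: ifP.
  have DC i : i \in J -> D i = C i.
    by rewrite /D; case: eqP => // -> ; rewrite (negbTE nJ).
  have H1 : \bigcap_(i in `I_n) (X i @^-1` C i) = \bigcap_(i in [set` J]) (X i @^-1` D i).
    by rewrite JE; apply: eq_bigcapr => i /= iJ; rewrite DC.
  have H2 : (\bigcap_(i in `I_n) (X i @^-1` C i)) `&` X n @^-1` B =
      \bigcap_(i in [set` (n |` J)%fset]) (X i @^-1` D i).
    by rewrite bigcap_fsetU1 H1 /D eqxx setIC.
  rewrite H2 H1 !Xindep// big_fsetU1//= muleC; congr (_ * _)%E.
  by rewrite /D eqxx.
suff : <<d G >> A.
  move=> dGA.
  suff: <<d G >> `<=` [set A | measurable A /\ P (A `&` X n @^-1` B) = (P A * P (X n @^-1` B))%E].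
    by move=> /(_ _ dGA)[].
  have mXB : measurable (X n @^-1` B) by exact: measurable_funPTI.
  apply: smallest_sub; last exact: GP.
  split.
  - by split => //; rewrite setTI probability_setT mul1e.
  - move=> S [mS HS]; split; first exact: measurableC.
    have SB : measurable (S `&` X n @^-1` B) by exact: measurableI.
    have CB : measurable (~` S `&` X n @^-1` B) by apply: measurableI => //; exact: measurableC.
    have dSB : pr P (X n @^-1` B) = pr P (S `&` X n @^-1` B) + pr P (~` S `&` X n @^-1` B).
      rewrite -prU//; first by rewrite -setIUl setUv setTI.
      rewrite disj_set2E; apply/eqP; rewrite -subset0 => w [[? _] [? _]]; contradiction.
    move: HS; rewrite !prE//; last exact: measurableC.
    rewrite -!EFinM => -[HS]; congr EFin.
    by rewrite prC// mulrBl mul1r -HS dSB; ring.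
  - move=> F tF HF; split; first by apply: bigcup_measurable => k _; have [] := HF k.
    have mF k : measurable (F k) by have [] := HF k.
    rewrite setI_bigcupl !measure_bigcup//; last 2 first.
      by move=> i _; exact: measurableI.
      by under eq_fun do rewrite setIC; exact: trivIset_setIl.
    rewrite [RHS]muleC (prE P mXB) -nneseriesZl//.
    by apply: eq_eseriesr => i _; have [_ /= HH] := HF i; rewrite -(prE P mXB) muleC -HH.
rewrite setI_closed_g_dynkin_g_sigma_algebra//.
apply: sub_smallest2r pA; first exact: smallest_sigma_algebra.
move=> _ [i /= lin [C mC <-]].
exists (fun j => if j == i then C else setT); split.
  by move=> j; case: ifP.
apply/seteqP; split => w /=.
  by move=> [_ Cw] j _; case: eqP => [->//|].
by move=> /(_ i lin) /=; rewrite eqxx.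
Qed.

End Past.

(** * Laws of functions of the walk *)

Section RestrictedLaw.
Context d d' (T : measurableType d) (T' : measurableType d').
Context (R : realType) (P : probability T R).

(** The measurability proofs are arguments so that the measure structure can be
    inferred from the term. *)
Definition restricted_law (E : set T) (V : T -> T')
    (mE : measurable E) (mV : measurable_fun setT V) (B : set T') : \bar R :=
  P (E `&` V @^-1` B).

Variables (E : set T) (V : T -> T').
Hypotheses (mE : measurable E) (mV : measurable_fun setT V).
Local Notation law := (restricted_law mE mV).

Let mEV B : measurable B -> measurable (E `&` V @^-1` B).
Proof.
by move=> mB; apply: measurableI => //; rewrite -[X in measurable X]setTI; exact: mV.
Qed.

Let law0 : law set0 = 0%E.
Proof. by rewrite /restricted_law preimage_set0 setI0 measure0. Qed.

Let law_ge0 B : (0 <= law B)%E.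
Proof. exact: measure_ge0. Qed.

Let law_sigma_additive : semi_sigma_additive law.
Proof.
move=> F mF tF mUF; rewrite /restricted_law preimage_bigcup setI_bigcupr.
apply: measure_semi_sigma_additive.
- by move=> n; exact: mEV.
- apply/trivIsetP => i j _ _ ij.
  have /trivIsetP/(_ i j I I ij) Fij := tF.
  rewrite -subset0 => w [[_ Fi] [_ Fj]].
  by move/seteqP : Fij => [/(_ (V w)) + _]; apply; split.
- by rewrite -setI_bigcupr -preimage_bigcup; exact: mEV.
Qed.

HB.instance Definition _ := isMeasure.Build _ _ _ law
  law0 law_ge0 law_sigma_additive.

Let law_fin : fin_num_fun law.
Proof. by move=> B mB; apply: fin_num_measure; exact: mEV. Qed.

HB.instance Definition _ := Measure_isFinite.Build _ _ _ law law_fin.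

End RestrictedLaw.

(** Both sides are the mass that the joint law of (V, Y) on the event E gives to
    the half plane z < v + y; uniqueness of the product measure identifies this
    joint law, and the right-hand side integrates the sections in v first. *)
Lemma convolution d (T : measurableType d) (R : realType)
    (P : probability T R) (E : set T) (V Y : T -> R) (Q : probability R R) (z : R) :
  measurable E -> measurable_fun setT V -> measurable_fun setT Y ->
  (forall A B, measurable A -> measurable B ->
     P ((E `&` V @^-1` A) `&` Y @^-1` B) = (P (E `&` V @^-1` A) * Q B)%E) ->
  pr P (E `&` [set w | z < V w + Y w]) =
  \int[Q]_y pr P (E `&` [set w | z - y < V w]).
Proof.
move=> mE mV mY indep.
pose VY w := (V w, Y w).
have mVY : measurable_fun setT VY by apply: measurable_fun_pair.
pose C : set (R * R) := [set p | z < p.1 + p.2].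
have mC : measurable C.
  have -> : C = (fun p : R * R => p.1 + p.2) @^-1` `]z, +oo[.
    by apply/seteqP; split => p; rewrite /C /= in_itv/= andbT.
  rewrite -[X in measurable X]setTI.
  by apply: (measurable_funD measurable_fst measurable_snd).
pose m1 := restricted_law P mE mV.
pose m' := restricted_law P mE mVY.
have e1 : (m1 \x Q)%E C = m' C.
  apply: product_measure_unique => // A B mA mB.
  rewrite -[RHS]indep// /m' /restricted_law; congr (P _).
  by rewrite -setIA.
have e2 : (m1 \x Q)%E C = (m1 \x^ Q)%E C.
  by apply: product_measure_unique => // A B mA mB; exact: product_measure2E.
transitivity (fine (m' C)); first by [].
rewrite -e1 e2 /Rintegral /product_measure2; congr fine.
apply: eq_integral => y _ /=.
have <- : V @^-1` (ysection C y) = [set w | z - y < V w].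
  by apply/seteqP; split => w; rewrite /ysection /C /= inE/= ltrBlDr.
rewrite -/(m1 _) -/(pr P _) -prE//; apply: measurableI => //.
by rewrite -[X in measurable X]setTI; apply: (mV measurableT); exact: measurable_ysection.
Qed.

Section Walk.
Context d (T : measurableType d) (R : realType) (P : probability T R).
Variables (X : nat -> {RV P >-> R}) (Q : probability R R).
Hypothesis Xindep : mutually_independent X.
Hypothesis XQ : forall n B, measurable B -> P (X n @^-1` B) = Q B.

Lemma past_setT n : past X n setT.
Proof. exact: (@measurableT _ (g_sigma_algebraType (past_generators X n))). Qed.

(** The event E is what distinguishes this from a plain convolution: it allows
    conditioning on a first passage in [increment_tail]. *)
Lemma past_convolution n E V z : past X n E -> past_measurable X n V ->
  pr P (E `&` [set w | z < V w + X n w]) =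
  \int[Q]_y pr P (E `&` [set w | z - y < V w]).
Proof.
move=> pE pV; apply: convolution => //.
- exact: past_sub_measurable pE.
- exact: past_measurable_ambient pV.
- move=> A B mA mB; rewrite past_indep// ?XQ//.
  apply: (@measurableI _ (g_sigma_algebraType (past_generators X n))) => //.
  by rewrite -[X in measurable X]setTI; exact: pV.
Qed.

Lemma past_measurable_sum k n :
  past_measurable X n (fun w => \sum_(k <= i < n) X i w).
Proof.
rewrite /past_measurable; have H (w : T) : \sum_(k <= i < n) X i w =
  \sum_(i <- index_iota k n) (if (i < n)%N then X i w else 0).
  by apply: eq_big_nat => i /andP[_ ->].
under eq_fun do rewrite H.
apply: (@measurable_sum _ (g_sigma_algebraType (past_generators X n))) => i.
case: ltnP => [ik|_]; last exact: measurable_cst.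
exact: (past_measurableX ik).
Qed.

Fixpoint lindley n w : R :=
  if n is m.+1 then Num.max 0 (lindley m w + X m w) else 0.

Lemma past_measurable_lindley n : past_measurable X n (lindley n).
Proof.
elim: n => [|n IH].
  by change (past_measurable X 0 (cst 0)); exact: measurable_cst.
apply: (@measurable_maxr _ (g_sigma_algebraType (past_generators X n.+1))); first exact: measurable_cst.
apply: (@measurable_funD _ (g_sigma_algebraType (past_generators X n.+1))); first exact: past_measurable_le IH.
exact: past_measurableX.
Qed.

Lemma lindley_tail n x : pr P [set w | x < lindley n w] = wait Q n x.
Proof.
elim: n x => [|n IH] x /=.
  case: ifP => x0.
    by rewrite (_ : [set _ | _] = setT) ?prT//; apply/seteqP; split.
  by rewrite (_ : [set _ | _] = set0) /pr ?measure0//; apply/seteqP; split.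
case: ifPn => [x0|].
  rewrite (_ : [set _ | _] = setT) ?prT//; apply/seteqP; split => // w _ /=.
  by rewrite lt_max x0.
rewrite -leNgt => x0.
rewrite (_ : [set _ | _] = setT `&` [set w | x < lindley n w + X n w]); last first.
  by rewrite setTI; apply/seteqP; split => w /=; rewrite lt_max ltNge x0.
rewrite (past_convolution _ (@past_setT n) (@past_measurable_lindley n)).
by apply: eq_Rintegral => y _; rewrite setTI IH.
Qed.

Lemma lindleyS n w : lindley n.+1 w = Num.max 0 (lindley n w + X n w).
Proof. by []. Qed.

Lemma past_gt n V x : past_measurable X n V -> past X n [set w | x < V w].
Proof.
move=> pV.
have -> : [set w | x < V w] = V @^-1` `]x, +oo[.
  by apply/seteqP; split => w; rewrite /= in_itv/= andbT.
by rewrite -[X in past _ _ X]setTI; exact: pV.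
Qed.

Definition sum_tail n x : R := pr P [set w | x < partial_sum X n w].

Lemma past_partial_sum n m : (n <= m)%N -> past_measurable X m (partial_sum X n).
Proof.
move=> nm; apply: past_measurable_le nm _.
have -> : partial_sum X n = fun w => \sum_(0 <= i < n) X i w.
  by apply/funext => w; rewrite big_mkord.
exact: past_measurable_sum.
Qed.

Lemma measurable_partial_sum n : measurable_fun setT (partial_sum X n).
Proof. exact: past_measurable_ambient (past_partial_sum (leqnn n)). Qed.

Lemma measurable_sum_gt n x : measurable [set w | x < partial_sum X n w].
Proof. exact: past_sub_measurable (past_gt _ (past_partial_sum (leqnn n))). Qed.

Lemma sum_tail_ge0 n x : 0 <= sum_tail n x. Proof. exact: pr_ge0. Qed.

Lemma sum_tail_le1 n x : sum_tail n x <= 1.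
Proof. by apply: pr_le1; exact: measurable_sum_gt. Qed.

Lemma sum_tail_noninc n x y : x <= y -> sum_tail n y <= sum_tail n x.
Proof.
move=> xy; apply: pr_le; [exact: measurable_sum_gt..|].
by move=> w /=; exact: le_lt_trans.
Qed.

Lemma partial_sumS n w : partial_sum X n.+1 w = partial_sum X n w + X n w.
Proof. by rewrite /partial_sum big_ord_recr. Qed.

Lemma sum_tail0 x : sum_tail 0 x = if x < 0 then 1 else 0.
Proof.
rewrite /sum_tail; case: ifP => x0.
  rewrite (_ : [set _ | _] = setT) ?prT//; apply/seteqP; split => // w _ /=.
  by rewrite /partial_sum big_ord0.
rewrite (_ : [set _ | _] = set0) /pr ?measure0//; apply/seteqP; split => // w /=.
by rewrite /partial_sum big_ord0 x0.
Qed.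

Lemma sum_tailS n x : sum_tail n.+1 x = \int[Q]_y sum_tail n (x - y).
Proof.
rewrite /sum_tail (_ : [set _ | _] = setT `&` [set w | x < partial_sum X n w + X n w]).
  rewrite (past_convolution _ (@past_setT n) (past_partial_sum (leqnn n))).
  by apply: eq_Rintegral => y _; rewrite setTI.
by rewrite setTI; apply/seteqP; split => w /=; rewrite partial_sumS.
Qed.

Lemma bounded_sum_tail n x : bounded_measurable (fun y : R => sum_tail n (x - y)).
Proof.
apply: bounded_reflect; first exact: sum_tail_noninc.
by move=> y; rewrite sum_tail_ge0 sum_tail_le1.
Qed.

Lemma sum_tail_le_wait n x : sum_tail n x <= wait Q n x.
Proof.
elim: n x => [|n IH] x; case: (ltP x 0) => x0;
  try by rewrite (wait_neg _ _ x0) sum_tail_le1.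
  by rewrite sum_tail0 ltNge x0 wait_ge0.
rewrite sum_tailS waitS//; apply: Rint_le; [exact: bounded_sum_tail|exact: bounded_wait|].
by move=> y; exact: IH.
Qed.

(** Markov property of the walk at time k. *)
Lemma increment_tail k m E z : past X k E ->
  pr P (E `&` [set w | z < partial_sum X (k + m) w - partial_sum X k w]) =
  pr P E * sum_tail m z.
Proof.
move=> pE; elim: m z => [|m IH] z.
  rewrite sum_tail0 addn0.
  rewrite (_ : [set _ | _] = [set w : T | z < 0]); last first.
    by apply/seteqP; split=> w /=; rewrite subrr.
  case: ifP => z0; first by rewrite (_ : [set _ | _] = setT) ?setIT ?mulr1//; apply/seteqP.
  rewrite (_ : [set _ | _] = set0) ?setI0 ?mulr0 /pr ?measure0//.
  by apply/seteqP; split => // w.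
rewrite sum_tailS -RintZ; last exact: bounded_sum_tail.
rewrite (_ : [set _ | _] = [set w | z <
    (partial_sum X (k + m) w - partial_sum X k w) + X (k + m)%N w]); last first.
  by apply/seteqP; split=> w /=; rewrite addnS partial_sumS addrAC.
rewrite past_convolution.
- by apply: eq_Rintegral => y _; rewrite IH.
- exact: past_generators_sub (leq_addr _ _) _ pE.
- apply: (@measurable_funB _ (g_sigma_algebraType (past_generators X (k + m)))).
    exact: past_partial_sum.
  by apply: past_partial_sum; exact: leq_addr.
Qed.

Definition crossed k x : set T := [set w | exists2 i, (i <= k)%N & x < partial_sum X i w].

Lemma past_crossed k x : past X k (crossed k x).
Proof.
have -> : crossed k x = \bigcup_(i in `I_k.+1) [set w | x < partial_sum X i w].
  by apply/seteqP; split => w [i]; exists i.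
apply: (@fin_bigcup_measurable _ (g_sigma_algebraType (past_generators X k))) => // i /= ik.
by apply: past_gt; exact: past_partial_sum.
Qed.

Lemma measurable_crossed k x : measurable (crossed k x).
Proof. exact: past_sub_measurable (@past_crossed k x). Qed.

Lemma partial_max_gt n x : [set w | x < partial_max X n w] = crossed n x.
Proof.
apply/seteqP; split => w; rewrite /crossed /=.
  move=> xM; apply: contrapT => /forall2NP H.
  move: xM; rewrite ltNge => /negP; apply.
  have le i : (i <= n)%N -> partial_sum X i w <= x.
    by move=> i_n; rewrite leNgt; apply/negP; have [] := H i.
  rewrite /partial_max big_nat; apply: bigmax_le; first exact: le.
  by move=> i /andP[_]; exact: le.
move=> [i i_n xi]; apply: (lt_le_trans xi).
apply: (le_bigmax_seq (r := index_iota 0 n.+1) (partial_sum X 0 w) i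
  xpredT (fun i => partial_sum X i w)) => //.
by rewrite mem_index_iota.
Qed.

(** Ottaviani's inequality.  After the first passage above x at time k, the walk
    ends above x - A as soon as S_n - S_k > - A, an event independent of the
    passage.  The induction adds the passage times k one by one. *)
Lemma ottaviani q A n x : (forall m, q <= sum_tail m (- A)) ->
  q * pr P (crossed n x) <= sum_tail n (x - A).
Proof.
move=> hq.
pose G := [set w | x - A < partial_sum X n w].
have mG : measurable G by exact: measurable_sum_gt.
suff key : forall k, (k <= n)%N -> q * pr P (crossed k x) <= pr P (crossed k x `&` G).
  apply: le_trans (key n (leqnn n)) _; apply: pr_le => //.
  by apply: measurableI => //; exact: measurable_crossed.
have first k F : (k <= n)%N -> past X k F -> F `<=` [set w | x < partial_sum X k w] ->
    q * pr P F <= pr P (F `&` G).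
  move=> kn pF Fx; rewrite mulrC.
  apply: le_trans (_ : pr P F * sum_tail (n - k) (- A) <= _).
    by rewrite ler_wpM2l ?pr_ge0.
  rewrite -(increment_tail (n - k) (- A) pF) subnKC//.
  have mF := past_sub_measurable pF.
  apply: pr_le; last by move=> w [Fw /=]; have := Fx _ Fw; rewrite /G /= => ? ?; split => //; lra.
    apply: measurableI => //; apply: past_sub_measurable (past_gt _ _).
    apply: (@measurable_funB _ (g_sigma_algebraType (past_generators X n))).
      exact: past_partial_sum.
    exact: past_partial_sum.
  exact: measurableI.
elim=> [|k IH] kn.
  by apply: (first 0%N) => //; [exact: past_crossed|move=> w [[]]].
pose F := [set w | x < partial_sum X k.+1 w] `\` crossed k x.
have pF : past X k.+1 F.
  apply: (@measurableD _ (g_sigma_algebraType (past_generators X k.+1))).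
    by apply: past_gt; exact: past_partial_sum.
  exact: past_generators_sub (leqnSn k) _ (@past_crossed k x).
have mF := past_sub_measurable pF.
have mc := measurable_crossed k x.
have -> : crossed k.+1 x = crossed k x `|` F.
  apply/seteqP; split => w.
    move=> [i ik xi]; have [ck|nck] := pselect (crossed k x w); [by left|right; split => //].
    by move: ik xi; rewrite leq_eqVlt => /predU1P[->//|ik xi]; case: nck; exists i.
  by move=> [[i ik xi]|[xk _]]; [exists i => //; exact: leqW|exists k.+1].
have dF : [disjoint crossed k x & F].
  by rewrite disj_set2E; apply/eqP; rewrite -subset0 => w [? []].
rewrite setIUl !prU//; [|exact: measurableI..|].
  rewrite mulrDr lerD ?IH// 1?ltnW//; apply: (first k.+1) => // w []//.
rewrite disj_set2E; apply/eqP; rewrite -subset0 => w [[? _] [[_ ?] _]]//.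
Qed.

(** [ottaviani] in the form in which the factor close to 1 is on the right. *)
Lemma crossed_le eta A n x : 0 < eta ->
  (forall m, 1 - eta / (1 + eta) <= sum_tail m (- A)) ->
  pr P (crossed n x) <= (1 + eta) * sum_tail n (x - A).
Proof.
move=> eta0 H; have eta1 : 0 < 1 + eta by lra.
have := ottaviani n x H; have -> : 1 - eta / (1 + eta) = (1 + eta)^-1.
  by field; rewrite lt0r_neq0.
by rewrite ler_pdivrMl.
Qed.

End Walk.

(** * Walks with negative drift *)

Lemma integrable_EFinD d (T : measurableType d) (R : realType)
    (P : probability T R) (f g : T -> R) :
  P.-integrable [set: T] (EFin \o f) -> P.-integrable [set: T] (EFin \o g) ->
  P.-integrable [set: T] (EFin \o (fun w => f w + g w)).
Proof. by move=> If Ig; exact: (integrableD measurableT If Ig). Qed.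

Section Drift.
Context d (T : measurableType d) (R : realType) (P : probability T R).
Variables (X : nat -> {RV P >-> R}) (Q : probability R R).
Hypothesis Xindep : mutually_independent X.
Hypothesis XQ : forall n B, measurable B -> P (X n @^-1` B) = Q B.
Hypothesis Qint : Q.-integrable [set: R] (EFin : R -> \bar R).

Lemma integral_step n (f : R -> R) : measurable_fun setT f ->
  Q.-integrable [set: R] (EFin \o f) ->
  P.-integrable [set: T] (fun w => (f (X n w))%:E) /\
  \int[P]_w f (X n w) = \int[Q]_y f y.
Proof.
move=> mf If.
have mfX : measurable_fun setT (fun w => f (X n w)) by exact: measurableT_comp.
have IfX : P.-integrable [set: T] (fun w => (f (X n w))%:E).
  apply/integrableP; split; first exact/measurable_EFinP.
  have /integrableP[_] := If.
  rewrite (@eq_measure_integral _ _ _ setT (distribution P (X n))); last first.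
    by move=> A mA _; exact/esym/XQ.
  rewrite ge0_integral_distribution//.
  by apply: measurableT_comp => //; exact/measurable_EFinP.
split => //; rewrite /Rintegral; congr fine.
rewrite [RHS](@eq_measure_integral _ _ _ setT (distribution P (X n))); last first.
  by move=> A mA _; exact/esym/XQ.
by rewrite integral_distribution//; exact/measurable_EFinP.
Qed.

Lemma integrable_max b : Q.-integrable [set: R] (fun y : R => (Num.max y (- b))%:E).
Proof.
apply: (@le_integrable _ _ _ Q setT _ _ (fun y : R => (`|y| + `|b|)%:E)) => //.
- by apply/measurable_EFinP; exact: measurable_maxr.
- move=> y _ /=; rewrite lee_fin [leRHS]ger0_norm ?addr_ge0//.
  rewrite maxEle; case: ifP => _; first by rewrite normrN lerDr.
  by rewrite lerDl.
- under eq_fun do rewrite EFinD.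
  apply: integrableD => //; first exact: integrable_norm Qint.
  exact: finite_measure_integrable_cst.
Qed.

(** Truncating the steps far below keeps the mean negative, by dominated
    convergence; the truncation level b enters [lindley_mean_step]. *)
Lemma truncated_mean_lt0 : \int[Q]_y y < 0 ->
  exists b, 0 <= b /\ \int[Q]_y (Num.max y (- b)) < 0.
Proof.
move=> Q0.
have cv : (\int[Q]_y (Num.max y (- n%:R))%:E)%E @[n --> \oo] --> (\int[Q]_y y%:E)%E.
  have [] // := @dominated_convergence _ _ _ Q setT measurableT
    (fun n y => (Num.max y (- n%:R))%:E) (EFin : R -> \bar R) (fun y : R => (`|y|)%:E).
  - by move=> n; apply/measurable_EFinP; exact: measurable_maxr.
  - apply: aeW => y _; apply: cvg_near_cst; near=> n.
    rewrite max_l// lerNl (le_trans (ler_norm _))// normrN.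
    by near: n; exact: nbhs_infty_ger.
  - exact: integrable_norm Qint.
  - apply: aeW => y n _ /=; rewrite lee_fin.
    rewrite maxEle; case: ifP => // yn; rewrite normrN ger0_norm//.
    by rewrite -normrN (le_trans _ (ler_norm _))// lerNr.
have fin : (\int[Q]_y y%:E)%E \is a fin_num by exact: integrable_fin_num.
move: cv; rewrite -(fineK fin) => /fine_cvgP[_ /cvgr_lt/(_ _ Q0)].
by case=> N _ /(_ N (leqnn N)) /= HN; exists N%:R.
Unshelve. all: by end_near. Qed.

Let mean_wait n : R := \int[P]_w lindley X n w.

Lemma lindley_ge0 n w : 0 <= lindley X n w.
Proof. by case: n => [|n] //=; rewrite le_max lexx. Qed.

Lemma measurable_lindley n : measurable_fun setT (lindley X n).
Proof. exact: past_measurable_ambient (@past_measurable_lindley _ _ _ _ X n). Qed.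

Lemma integrable_lindley n : P.-integrable [set: T] (EFin \o lindley X n).
Proof.
elim: n => [|n IH].
  apply: (eq_integrable measurableT (cst 0%E)) => //.
  exact: finite_measure_integrable_cst.
have [IX _] := integral_step n (@measurable_id _ _ _) Qint.
apply: (@le_integrable _ _ _ P setT _ _ (fun w => (lindley X n w)%:E + (X n w)%:E)%E) => //.
- by apply/measurable_EFinP; exact: measurable_lindley.
- move=> w _; rewrite lee_fin lindleyS maxEle; by case: ifP => // _; rewrite normr0.
- exact: integrableD.
Qed.

(** W_{n+1} - W_n = max(Y_n, - W_n), which is at most max(Y_n, - b) on the event
    W_n > b, and exceeds it by at most b otherwise. *)
Lemma lindley_mean_step n b : 0 <= b ->
  mean_wait n.+1 <= mean_wait n + \int[Q]_y (Num.max y (- b)) + b * (1 - wait Q n b).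
Proof.
move=> b0.
have mmax : measurable_fun [set: R] (fun y : R => Num.max y (- b)) by exact: measurable_maxr.
have [IX <-] := integral_step n mmax (integrable_max b).
have mW : measurable [set w | b < lindley X n w].
  by apply: past_sub_measurable; apply: past_gt; exact: past_measurable_lindley.
pose A : set T := ~` [set w | b < lindley X n w].
rewrite -(lindley_tail Xindep XQ) -prC// -/A /pr -Rint_indic; last exact: measurableC.
have bi : bounded_measurable (\1_A : T -> R).
  by apply: bounded_measurable_indic; exact: measurableC.
rewrite -(RintZ P _ bi) -RintegralD//; last exact: integrable_lindley.
rewrite -RintegralD//; last 2 first.
- by apply: integrable_EFinD => //; exact: integrable_lindley.
- by apply: bounded_measurable_integrable; exact: bounded_measurableZ.
apply: le_Rintegral => //; first exact: integrable_lindley.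
- apply: integrable_EFinD; first by apply: integrable_EFinD => //; exact: integrable_lindley.
  by apply: bounded_measurable_integrable; exact: bounded_measurableZ.
- move=> w _; rewrite lindleyS indicE /A in_setC.
  have W0 := lindley_ge0 n w.
  have [bW|bW] := ltP b (lindley X n w).
    rewrite mem_set//= mulr0 addr0 ge_max; apply/andP; split.
      by rewrite -lerBlDl sub0r le_max lerN2 (ltW bW) orbT.
    by rewrite lerD2l le_max lexx.
  rewrite memNset/= ?mulr1; last by apply/negP; rewrite -leNgt.
  have m1 : X n w <= Num.max (X n w) (- b) by rewrite le_max lexx.
  have m2 : - b <= Num.max (X n w) (- b) by rewrite le_max lexx orbT.
  by rewrite ge_max; apply/andP; split; lra.
Qed.

(** Otherwise P(W_n > b) tends to 1 for every b, and by [lindley_mean_step] the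
    mean of W_n eventually decreases by a fixed amount at each step, although W_n
    is nonnegative. *)
Lemma wait_sup_lt1 : \int[Q]_y y < 0 -> exists x, wait_sup Q x < 1.
Proof.
move=> /truncated_mean_lt0[b [b0 cb]]; exists b.
set c := (\int[Q]_y _) in cb.
rewrite ltNge; apply/negP => w1.
have [N HN] : exists N, b * (1 - wait Q N b) <= - c / 2.
  have d0 : 0 < - c / 2 / (b + 1) by rewrite !divr_gt0//; lra.
  have [_ [N _ <-] HN] := sup_adherent d0 (has_sup_wait Q b).
  exists N; have {}HN : 1 - wait Q N b < - c / 2 / (b + 1) by rewrite /wait_sup in w1; lra.
  apply: (@le_trans _ _ ((b + 1) * (- c / 2 / (b + 1)))).
    apply: ler_pM => //; [|lra|exact: ltW].
    by rewrite subr_ge0 wait_le1.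
  by rewrite mulrC divfK// lt0r_neq0//; lra.
have step k : mean_wait (N + k) <= mean_wait N + k%:R * (c / 2).
  elim: k => [|k IH]; first by rewrite addn0 mul0r addr0.
  rewrite addnS (le_trans (lindley_mean_step _ b0))// -/c.
  have : b * (1 - wait Q (N + k) b) <= b * (1 - wait Q N b).
    by rewrite ler_wpM2l// lerB// wait_nd// leq_addr.
  by rewrite -natr1 mulrDl mul1r; lra.
pose k := (Num.truncn (mean_wait N / (- c / 2))).+1.
have : 0 <= mean_wait (N + k) by apply: Rintegral_ge0 => w _; exact: lindley_ge0.
have c2 : 0 < - c / 2 by lra.
have : mean_wait N < k%:R * (- c / 2) by rewrite -ltr_pdivrMr// truncnS_gt.
by move: (step k); lra.
Qed.
End Drift.

(** * The class S* and long tails *)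

Section LongTail.
Context (R : realType) (F : probability R R).
Local Notation f := (tail F).
Local Notation mu := (@lebesgue_measure R).

Lemma measurable_tail : measurable_fun [set: R] f.
Proof. by apply: nonincreasing_measurable => // x y; exact: tail_noninc. Qed.

(** Lebesgue measure is invariant under y |-> x - y, since the image measure
    agrees with it on half-open intervals. *)
Lemma reflect_integral (x : R) :
  \int[mu]_(y in `[x / 2, x]) f (x - y) = \int[mu]_(y in `[0, x / 2]) f y.
Proof.
pose phi (y : measurableTypeR R) : measurableTypeR R := x - y.
have mphi : measurable_fun setT phi by exact: measurable_funB.
have <- : phi @^-1` `[0, x / 2] = `[x / 2, x]%classic.
  by apply/seteqP; split => y; rewrite /phi /= !in_itv/= => /andP[? ?]; apply/andP; split; lra.
rewrite /Rintegral; congr fine.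
rewrite -(ge0_integral_pushforward mphi mu _ (f := EFin \o f))//; last 2 first.
- by apply/measurable_EFinP; apply: measurable_funTS; exact: measurable_tail.
- by move=> y _; rewrite lee_fin tail_ge0.
apply: eq_measure_integral => A mA _.
apply/esym; apply: lebesgue_measure_unique => // _ [[a b] ab <-].
change (mu `]a, b]%classic = mu (phi @^-1` `]a, b]%classic)).
have -> : phi @^-1` `]a, b]%classic = `[x - b, x - a[%classic.
  by apply/seteqP; split => y; rewrite /phi /= !in_itv/= => /andP[? ?]; apply/andP; split; lra.
rewrite !lebesgue_measure_itv/= !lte_fin.
have -> : (x - b < x - a) = (a < b) by apply/idP/idP; lra.
case: ifP => // _; rewrite -!EFinD; congr EFin; ring.
Qed.

Lemma interval_integrable (g : R -> R) (a b : R) M :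
  measurable_fun [set: R] g -> (forall y, `|g y| <= M) ->
  mu.-integrable `[a, b] (EFin \o g).
Proof.
move=> mg gM; apply: measurable_bounded_integrable => //.
- by rewrite /= lebesgue_measure_itv/=; case: ifP => _; rewrite ?ltry// -EFinD ltry.
- exact: measurable_funTS.
- by exists M; split; [exact: num_real|move=> N MN y _; exact: le_trans (gM y) (ltW MN)].
Qed.

Lemma tail_norm y : `|f y| <= 1.
Proof. by rewrite ger0_norm ?tail_ge0// tail_le1. Qed.

Lemma tail_interval_integrable (a b : R) : mu.-integrable `[a, b] (EFin \o f).
Proof. by apply: (@interval_integrable _ _ _ 1); [exact: measurable_tail|exact: tail_norm]. Qed.

(** The two halves of [0, x] contribute symmetrically.  Each is bounded below with
    tail F x in place of the larger factor; on [h, 2 h] the first half gains the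
    increment of the tail over a distance h, which long-tailedness controls. *)
Lemma convolution_square_ge (x h : R) : 0 < h -> 4 * h < x ->
  2 * f x * \int[mu]_(y in `[0, x / 2]) f y + (f (x - h) - f x) * (f (2 * h) * h) <=
  \int[mu]_(y in `[0, x]) (f (x - y) * f y).
Proof.
move=> h0 hx.
have mr : measurable_fun [set: R] (fun y => f (x - y)).
  by apply: measurableT_comp; [exact: measurable_tail|exact: measurable_funB].
have Iff (a b : R) : mu.-integrable `[a, b] (EFin \o (fun y => f (x - y) * f y)).
  apply: (@interval_integrable _ _ _ 1).
    by apply: measurable_funM => //; exact: measurable_tail.
  by move=> y; rewrite normrM mulr_ile1 ?tail_norm.
have Ir (a b : R) : mu.-integrable `[a, b] (EFin \o (fun y => f (x - y))).
  by apply: (@interval_integrable _ _ _ 1) => // y; exact: tail_norm.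
have hsplit : `[0, x]%classic = `[0, x / 2[ `|` `[x / 2, x] :> set R.
  apply/seteqP; split => y /=; rewrite !in_itv/=.
    by move=> /andP[y0 yx]; case: (ltP y (x / 2)) => yh; [left|right]; apply/andP; split.
  by case=> /andP[? ?]; apply/andP; split; lra.
rewrite hsplit Rintegral_setU//; last 2 first.
- by rewrite -hsplit.
- rewrite disj_set2E; apply/eqP; rewrite -subset0 => y [] /=.
  by rewrite !in_itv/= => /andP[_ ?] /andP[? _]; lra.
have e1 : \int[mu]_(y in `[0, (x / 2)[) (f (x - y) * f y) =
    \int[mu]_(y in `[0, x / 2]) (f (x - y) * f y).
  apply: Rintegral_itv_bndo_bndc; apply: integrableS (Iff 0 (x / 2)) => //.
  by move=> y /=; rewrite !in_itv/= => /andP[-> /ltW].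
have H1 : f x * \int[mu]_(y in `[0, x / 2]) f y + (f (x - h) - f x) * (f (2 * h) * h) <=
    \int[mu]_(y in `[0, x / 2]) (f (x - y) * f y).
  pose B : set R := `[h, 2 * h]%classic.
  have mB : measurable B by exact: measurable_itv.
  have hB : \int[mu]_(y in `[0, x / 2]) \1_B y = h.
    rewrite /Rintegral integral_indic//.
    rewrite (_ : B `&` _ = B); last first.
      apply/seteqP; split => y /=; first by case.
      by rewrite /B /= !in_itv/= => /andP[? ?]; split => //; apply/andP; split; lra.
    rewrite /B /= lebesgue_measure_itv/= lte_fin.
    have -> : h < 2 * h by lra.
    by rewrite -EFinD/=; lra.
  have IB : mu.-integrable `[0, x / 2] (EFin \o (fun y => (f (x - h) - f x) * f (2 * h) * \1_B y)).
    apply: (@interval_integrable _ _ _ `|(f (x - h) - f x) * f (2 * h)|).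
      by apply: measurable_funM => //; exact: measurable_indic.
    move=> y; rewrite normrM indicE; case: (_ \in _); rewrite ?normr1 ?mulr1//.
    by rewrite normr0 mulr0.
  have IB1 : mu.-integrable `[0, x / 2] (EFin \o \1_B).
    apply: (@interval_integrable _ _ _ 1); first exact: measurable_indic.
    by move=> y; rewrite indicE; case: (_ \in _); rewrite ?normr1 ?normr0.
  have IF : mu.-integrable `[0, x / 2] (EFin \o (fun y => f x * f y)).
    apply: (@interval_integrable _ _ _ 1).
      by apply: measurable_funM => //; exact: measurable_tail.
    by move=> y; rewrite normrM mulr_ile1 ?tail_norm.
  have -> : f x * \int[mu]_(y in `[0, x / 2]) f y + (f (x - h) - f x) * (f (2 * h) * h) =
      \int[mu]_(y in `[0, x / 2]) (f x * f y + (f (x - h) - f x) * f (2 * h) * \1_B y).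
    rewrite RintegralD// RintegralZl//; last exact: tail_interval_integrable.
    by rewrite RintegralZl// hB mulrA.
  apply: le_Rintegral => //.
    have -> : EFin \o (fun y => f x * f y + (f (x - h) - f x) * f (2 * h) * \1_B y) =
      (EFin \o (fun y => f x * f y)) \+
      (EFin \o (fun y => (f (x - h) - f x) * f (2 * h) * \1_B y)) by [].
    exact: integrableD.
  move=> y /=; rewrite in_itv/= => /andP[y0 yx].
  have fxy : f x <= f (x - y) by apply: tail_noninc; lra.
  have fy0 := tail_ge0 F y.
  rewrite indicE; case: (boolP (y \in B)) => [|_].
    rewrite inE /B /= in_itv/= => /andP[hy yh].
    have g1 : f (x - h) <= f (x - y) by apply: tail_noninc; lra.
    have g2 : f (2 * h) <= f y by apply: tail_noninc.
    have g3 : f x <= f (x - h) by apply: tail_noninc; lra.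
    have : (f (x - h) - f x) * f (2 * h) <= (f (x - y) - f x) * f y.
      by apply: ler_pM; rewrite ?subr_ge0 ?tail_ge0// lerB.
    by rewrite mulr1 mulrBl; lra.
  by rewrite mulr0 addr0 ler_wpM2r.
have H2 : f x * \int[mu]_(y in `[0, x / 2]) f y <=
    \int[mu]_(y in `[x / 2, x]) (f (x - y) * f y).
  rewrite -reflect_integral -RintegralZl//.
  apply: le_Rintegral => //.
    apply: (@interval_integrable _ _ _ 1); first exact: measurable_funM.
    by move=> y; rewrite normrM mulr_ile1 ?tail_norm.
  move=> y /=; rewrite in_itv/= => /andP[_ yx].
  by rewrite mulrC ler_wpM2l ?tail_ge0// tail_noninc.
rewrite e1; apply: le_trans (lerD H1 H2); rewrite le_eqVlt; apply/orP; left; apply/eqP.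
by ring.
Qed.

(** In the class S* the convolution square is asymptotic to twice the main term
    of [convolution_square_ge], so the remaining gain, a positive multiple of
    tail F (x - h) - tail F x, is o(tail F x). *)
Lemma Sstar_long_tailed : class_Sstar F -> forall h e, 0 < h -> 0 < e ->
  \forall x \near +oo, f (x - h) <= (1 + e) * f x.
Proof.
move=> [_ f0]; set a := (\int[_]_(_ in _) _) => cv h e h0 e0.
have a_ge0 : 0 <= a by apply: Rintegral_ge0 => y _; exact: tail_ge0.
(* A vanishing a would make the ratio in the definition identically 0. *)
have a0 : 0 < a.
  rewrite lt_neqAle a_ge0 andbT eq_sym; apply/eqP => a0; move: cv.
  rewrite /asymp_equiv; under eq_fun do rewrite a0 mulr0 mul0r invr0 mulr0.
  move=> cv; have h10 : 1 = 0 :> R := cvg_unique (@Rhausdorff R) cv (cvg_cst (0 : R)).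
  by move: (oner_neq0 R); rewrite h10 eqxx.
pose J x := \int[mu]_(y in `[0, x / 2]) f y.
have JA d : 0 < d -> \forall x \near +oo, a - d <= J x.
  move=> d0.
  have afin : (\int[mu]_(y in `[0%R, +oo[) (f y)%:E)%E \is a fin_num.
    apply: contra_ltT a0; rewrite fin_numEn /a /Rintegral => /orP[] /eqP ->;
    exact: lexx.
  have cvJ : (\int[mu]_(y in `[0%R, n%:R]) (f y)%:E)%E @[n --> \oo] --> a%:E.
    rewrite /a /Rintegral fineK//.
    have -> : `[0%R, +oo[%classic = \bigcup_n `[0%R, n%:R]%classic :> set R.
      apply/seteqP; split => y /=; rewrite ?in_itv/= ?andbT.
        move=> y0; exists (Num.truncn y).+1 => //=.
        by rewrite in_itv/= y0 ltW// truncnS_gt.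
      by move=> [n _ /=]; rewrite in_itv/= => /andP[].
    apply: ge0_nondecreasing_set_cvg_integral => //.
    - move=> n m nm; apply/subsetPset => y /=; rewrite !in_itv/= => /andP[-> yn]/=.
      by rewrite (le_trans yn)// ler_nat.
    - move=> n; apply/measurable_EFinP; apply: measurable_funTS; exact: measurable_tail.
    - by move=> n y _; rewrite lee_fin tail_ge0.
  have ad : a - d < a by lra.
  have /fine_cvgP[_ /cvgr_gt/(_ _ ad)[N _ /(_ N (leqnn N))/= HN]] := cvJ.
  near=> x; apply: le_trans (ltW HN) _.
  have Nx : 2 * N%:R <= x by near: x; exact: nbhs_pinfty_ge (num_real _).
  apply: fine_le; [exact: integrable_fin_num (tail_interval_integrable _ _)..|].
  apply: ge0_subset_integral => //.
  - apply/measurable_EFinP; apply: measurable_funTS; exact: measurable_tail.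
  - by move=> y _; rewrite lee_fin tail_ge0.
  - by move=> y /=; rewrite !in_itv/= => /andP[-> ?] /=; lra.
pose d := e * (f (2 * h) * h) / (2 * (a + 1)).
have d0 : 0 < d by rewrite !mulr_gt0// invr_gt0; lra.
have cv1 : \forall x \near +oo,
    \int[mu]_(y in `[0, x]) (f (x - y) * f y) <= (1 + d) * (2 * a * f x).
  have d1 : 1 < 1 + d by rewrite ltrDl.
  move/cvgr_lt : cv => /(_ _ d1); apply: filterS => x /=; rewrite ltr_pdivrMr ?mulr_gt0//.
  exact: ltW.
near=> x.
have hx : 4 * h < x by near: x; exact: nbhs_pinfty_gt (num_real _).
have I1 := convolution_square_ge h0 hx.
have I2 : \int[mu]_(y in `[0, x]) (f (x - y) * f y) <= (1 + d) * (2 * a * f x) by near: x.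
have I3 : a - d <= J x by near: x; exact: JA d0.
have I4 : 2 * f x * (a - d) <= 2 * f x * J x by rewrite ler_wpM2l// mulr_ge0// ltW.
have I5 : (f (x - h) - f x) * (f (2 * h) * h) <= (e * f x) * (f (2 * h) * h).
  have -> : (e * f x) * (f (2 * h) * h) = 2 * (a + 1) * d * f x.
    by rewrite /d; field; lra.
  by rewrite -/(J x) in I1; lra.
have : f (x - h) - f x <= e * f x by move: I5; rewrite ler_pM2r// mulr_gt0.
by lra.
Unshelve. all: by end_near. Qed.

End LongTail.

(** * Intermediate regular variation *)

Lemma scale_cvgy (R : realType) (c : R) : 0 < c -> c * x @[x --> +oo] --> +oo.
Proof. by move=> c0; apply: gt0_cvgMry => //; exact: cvg_id. Qed.

Lemma shift_cvgy (R : realType) (c : R) : x + c @[x --> +oo] --> +oo.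
Proof.
apply/cvgryPge => M; near=> x; rewrite -lerBlDr; near: x.
by apply: nbhs_pinfty_ge; exact: num_real.
Unshelve. all: by end_near. Qed.

Section IntermediateRegularVariation.
Context (R : realType) (G : probability R R).
Local Notation g := (tail G).

Lemma irv_near : intermediate_regularly_varying G -> forall eta, 0 < eta ->
  exists t, 0 < t /\ t < 1 /\ \forall x \near +oo, g (t * x) <= (1 + eta) * g x.
Proof.
move=> [g0 cv] eta eta0.
have eta1 : 1 < 1 + eta by rewrite ltrDl.
have /fine_cvgP[Hfin /cvgr_lt/(_ _ eta1) Hlt] := cv.
near (0 : R)^'+ => e.
have e0 : 0 < e by near: e; exact: nbhs_right_gt.
have e1 : e < 1 by near: e; exact: nbhs_right_lt.
have efin : limf_esup (fun x : R => (g ((1 - e) * x) / g x)%:E) (pinfty_nbhs R) \is a fin_num.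
  by near: e.
have elt : fine (limf_esup (fun x : R => (g ((1 - e) * x) / g x)%:E) (pinfty_nbhs R)) < 1 + eta.
  by near: e.
exists (1 - e); split; first by lra.
split; first by lra.
have : (limf_esup (fun x : R => (g ((1 - e) * x) / g x)%:E) (pinfty_nbhs R) < (1 + eta)%:E)%E.
  by rewrite -(fineK efin) lte_fin.
rewrite /limf_esup => /ereal_inf_lt[_ [V VF <-] HV].
apply: filterS VF => x Vx.
rewrite -ler_pdivrMr// -lee_fin; apply: le_trans (ltW HV).
by apply: ereal_sup_ubound; exists x.
Unshelve. all: by end_near. Qed.

(** Iterating [irv_near] with a fixed ratio r < 1 reaches any scale t, at the cost
    of a constant: intermediate regular variation implies dominated variation. *)
Lemma irv_dominated : intermediate_regularly_varying G -> forall t, 0 < t ->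
  exists C, 0 < C /\ \forall x \near +oo, g (t * x) <= C * g x.
Proof.
move=> irv t t0; have [r [r0 [r1 Hr]]] := irv_near irv ltr01.
have [k rk] : exists k, r ^+ k <= t.
  have /cvgrPdist_lt/(_ _ t0)[k _ /(_ k (leqnn k))] : r ^+ n @[n --> \oo] --> (0 : R).
    by apply: cvg_expr; rewrite gtr0_norm.
  by rewrite /= sub0r normrN ger0_norm ?exprn_ge0 ?ltW// => /ltW; exists k.
exists ((1 + 1) ^+ k); split; first by rewrite exprn_gt0.
have H : \forall x \near +oo, g (r ^+ k * x) <= (1 + 1) ^+ k * g x.
  elim: k {rk} => [|k IH]; first by near=> x; rewrite !mul1r.
  have IH' : \forall x \near +oo, g (r ^+ k * (r * x)) <= (1 + 1) ^+ k * g (r * x).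
    exact: scale_cvgy r0 _ IH.
  near=> x; rewrite exprSr -mulrA (@le_trans _ _ ((1 + 1) ^+ k * g (r * x)))//.
    by near: x.
  by rewrite exprSr -mulrA ler_wpM2l ?exprn_ge0//; near: x.
near=> x; apply: (@le_trans _ _ (g (r ^+ k * x))).
  apply: tail_noninc; rewrite ler_wpM2r//; near: x; exact: nbhs_pinfty_ge (num_real _).
by near: x.
Unshelve. all: by end_near. Qed.

End IntermediateRegularVariation.

(** * Walks with a changed drift *)

(** Steps a X + b, with a = 1 or a = -1, compare the walk with the lines n c
    from above and from below. *)
Definition affine (R : realType) (a b x : R) : R := a * x + b.

Lemma measurable_affine (R : realType) (a b : R) : measurable_fun [set: R] (affine a b).
Proof. by apply: measurable_funD => //; exact: measurable_funM. Qed.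

HB.instance Definition _ (R : realType) (a b : R) :=
  isMeasurableFun.Build _ _ _ _ (affine a b) (measurable_affine a b).

Section AffineWalk.
Context d (T : measurableType d) (R : realType) (P : probability T R).
Variables (X : nat -> {RV P >-> R}) (Q : probability R R).
Hypothesis Xindep : mutually_independent X.
Hypothesis XQ : forall n B, measurable B -> P (X n @^-1` B) = Q B.
Hypothesis Qint : Q.-integrable [set: R] (EFin : R -> \bar R).
Variables a b : R.

Definition affine_step n : {RV P >-> R} := affine a b \o X n.
Definition affine_law : probability R R := distribution Q (affine a b).

Lemma affine_step_indep : mutually_independent affine_step.
Proof.
move=> J B mB.
have mB' i : i \in J -> measurable (affine a b @^-1` B i).
  by move=> iJ; rewrite -[X in measurable X]setTI; apply: measurable_affine => //; exact: mB.
exact: (Xindep mB').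
Qed.

Lemma affine_step_law n B : measurable B -> P (affine_step n @^-1` B) = affine_law B.
Proof.
move=> mB; rewrite -[RHS](XQ n)//.
by rewrite -[X in measurable X]setTI; exact: measurable_affine.
Qed.

Lemma affine_integrable : Q.-integrable [set: R] (EFin \o affine a b).
Proof.
apply: integrable_EFinD; last exact: finite_measure_integrable_cst.
exact: (integrableZl measurableT a Qint).
Qed.

Lemma affine_law_integrable : affine_law.-integrable [set: R] (EFin : R -> \bar R).
Proof.
apply/integrableP; split; first exact/measurable_EFinP.
have /integrableP[_] := affine_integrable.
by rewrite ge0_integral_distribution//; exact: measurableT_comp.
Qed.

Lemma affine_law_mean : \int[affine_law]_y y = a * (\int[Q]_y y) + b.
Proof.
have -> : \int[affine_law]_y y = \int[Q]_y (affine a b y).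
  rewrite /Rintegral; congr fine; rewrite integral_distribution//.
  exact: affine_integrable.
rewrite RintegralD//; last 2 first.
- exact: (integrableZl measurableT a Qint).
- exact: finite_measure_integrable_cst.
by rewrite RintegralZl// Rint_cst.
Qed.

Lemma affine_sum n w : partial_sum affine_step n w = a * partial_sum X n w + n%:R * b.
Proof.
elim: n => [|n IH]; first by rewrite /partial_sum !big_ord0 mulr0 mul0r addr0.
by rewrite !partial_sumS IH /= /affine -natr1; ring.
Qed.

Hypothesis drift : a * (\int[Q]_y y) + b < 0.

Lemma affine_wait_sup_lt1 : exists x, wait_sup affine_law x < 1.
Proof.
apply: (wait_sup_lt1 affine_step_indep affine_step_law affine_law_integrable).
by rewrite affine_law_mean.
Qed.

Lemma affine_sum_le_wait n x :
  pr P [set w | x < a * partial_sum X n w + n%:R * b] <= wait affine_law n x.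
Proof.
have := sum_tail_le_wait affine_step_indep affine_step_law n x.
rewrite /sum_tail (_ : [set w | _] = [set w | x < a * partial_sum X n w + n%:R * b])//.
by apply/seteqP; split => w; rewrite /= affine_sum.
Qed.

(** For a walk with negative drift, exceeding a high level is unlikely uniformly
    in the number of steps: the form of the law of large numbers used here. *)
Lemma affine_sum_tight e : 0 < e -> \forall x \near +oo, forall n,
  pr P [set w | x < a * partial_sum X n w + n%:R * b] <= e.
Proof.
move=> e0; have := wait_tight affine_wait_sup_lt1 e0.
by apply: filterS => x H n; exact: le_trans (affine_sum_le_wait n x) (H n).
Qed.

End AffineWalk.

(** * A fixed number of steps *)

Section FixedNumberOfSteps.
Context d (T : measurableType d) (R : realType) (P : probability T R).
Variables (X : nat -> {RV P >-> R}) (Q : probability R R).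
Hypothesis Xindep : mutually_independent X.
Hypothesis XQ : forall n B, measurable B -> P (X n @^-1` B) = Q B.
Local Notation f := (tail Q).
Local Notation s n x := (sum_tail X n x).

Let half : (2^-1 : R) * x @[x --> +oo] --> +oo.
Proof. by apply: scale_cvgy; rewrite invr_gt0. Qed.

(** The last step y is at most h, or in (h, x / 2], or in (x / 2, x - h], or above
    x - h; the four terms bound the probability that the walk then exceeds x. *)
Lemma sum_tailS_upper n x h : 0 < h -> 2 * h <= x ->
  s n.+1 x <= s n (x - h) + f (x - h) + s n (x / 2) * f h + s n h * f (x / 2).
Proof.
move=> h0 hx; rewrite (sum_tailS Xindep XQ).
pose g (y : R) := s n (x - h) + over (x - h) y + s n (x / 2) * over h y + s n h * over (x / 2) y.
have b1 : bounded_measurable (fun y : R => s n (x - h) + over (x - h) y).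
  by apply: bounded_measurableD; [exact: bounded_measurable_cst|exact: bounded_over].
have b2 : bounded_measurable (fun y : R => s n (x / 2) * over h y).
  by apply: bounded_measurableZ; exact: bounded_over.
have b3 : bounded_measurable (fun y : R => s n h * over (x / 2) y).
  by apply: bounded_measurableZ; exact: bounded_over.
have b12 := bounded_measurableD b1 b2.
have -> : s n (x - h) + f (x - h) + s n (x / 2) * f h + s n h * f (x / 2) = \int[Q]_y g y.
  rewrite RintD// RintD// RintD//; [|exact: bounded_measurable_cst|exact: bounded_over].
  by rewrite !RintZ; [|exact: bounded_over..]; rewrite Rint_cst !Rint_over.
apply: Rint_le; [exact: bounded_sum_tail|exact: bounded_measurableD|].
move=> y; rewrite /g !overE.
have p1 := sum_tail_ge0 X n (x - h).
have p2 := sum_tail_ge0 X n (x / 2).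
have p3 := sum_tail_ge0 X n h.
have [y1|y1] := ltP (x - h) y.
  have := sum_tail_le1 X n (x - y).
  by case: ifP => _; case: ifP => _; lra.
have [y2|y2] := ltP (x / 2) y.
  have : s n (x - y) <= s n h by apply: sum_tail_noninc; lra.
  by case: ifP => _; lra.
have [y3|y3] := ltP h y.
  have : s n (x - y) <= s n (x / 2) by apply: sum_tail_noninc; lra.
  by lra.
have : s n (x - y) <= s n (x - h) by apply: sum_tail_noninc; lra.
by lra.
Qed.

(** The walk exceeds x if the last step is above x + h and the others sum to more
    than - h, or if it lies in (- h, x + h] and the others exceed x + h. *)
Lemma sum_tailS_lower n x h : 0 < h -> 0 <= x ->
  s n (x + h) * (f (- h) - f (x + h)) + s n (- h) * f (x + h) <= s n.+1 x.
Proof.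
move=> h0 hx; rewrite (sum_tailS Xindep XQ).
pose g (y : R) := s n (x + h) * (over (- h) y + (-1) * over (x + h) y) + s n (- h) * over (x + h) y.
have b0 : bounded_measurable (fun y : R => (-1) * over (x + h) y).
  by apply: bounded_measurableZ; exact: bounded_over.
have b1 : bounded_measurable (fun y : R => over (- h) y + (-1) * over (x + h) y).
  by apply: bounded_measurableD => //; exact: bounded_over.
have b2 : bounded_measurable (fun y : R => s n (x + h) * (over (- h) y + (-1) * over (x + h) y)).
  exact: bounded_measurableZ.
have b3 : bounded_measurable (fun y : R => s n (- h) * over (x + h) y).
  by apply: bounded_measurableZ; exact: bounded_over.
have -> : s n (x + h) * (f (- h) - f (x + h)) + s n (- h) * f (x + h) = \int[Q]_y g y.
  rewrite RintD// RintZ// RintD//; last exact: bounded_over.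
  by rewrite !RintZ; [|exact: bounded_over..]; rewrite !Rint_over mulN1r.
apply: Rint_le; [exact: bounded_measurableD|exact: bounded_sum_tail|].
move=> y; rewrite /g !overE.
have p1 := sum_tail_ge0 X n (x - y).
have [y1|y1] := ltP (x + h) y.
  have -> : - h < y by lra.
  have : s n (- h) <= s n (x - y) by apply: sum_tail_noninc; lra.
  by lra.
have [y2|y2] := ltP (- h) y.
  have : s n (x + h) <= s n (x - y) by apply: sum_tail_noninc; lra.
  by lra.
by lra.
Qed.

Lemma sum_tail_cvg0 n e : 0 < e -> \forall x \near +oo, s n x <= e.
Proof.
elim: n e => [|n IH] e e0.
  near=> x; rewrite sum_tail0 ltNge.
  have -> : 0 <= x by near: x; apply: nbhs_pinfty_ge; exact: num_real.
  exact: ltW.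
have e4 : 0 < e / 4 by lra.
have [M [_ HM]] : \forall x \near +oo, [/\ 0 < x, s n x <= e / 4 & f x < e / 4].
  near=> x; split; near: x; first by apply: nbhs_pinfty_gt; exact: num_real.
    exact: IH.
  exact: tail_cvg0.
near=> x.
have [|h0 sh fh] := HM (M + 1); first by lra.
set h := M + 1 in h0 sh fh.
have xh : 2 * h <= x by near: x; apply: nbhs_pinfty_ge; exact: num_real.
have [|_ s1 f1] := HM (x - h); first by rewrite /h; rewrite /h in xh; lra.
apply: le_trans (sum_tailS_upper n h0 xh) _.
have p2 := sum_tail_le1 X n (x / 2).
have f2 : f (x / 2) <= 1 by exact: tail_le1.
have q1 : s n (x / 2) * f h <= f h by rewrite ler_piMl// tail_ge0.
have q2 : s n h * f (x / 2) <= s n h by rewrite ler_piMr// sum_tail_ge0.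
by lra.
Unshelve. all: by end_near. Qed.

Lemma sum_tail_cvg1 n e : 0 < e -> \forall x \near +oo, 1 - e <= s n (- x).
Proof.
elim: n e => [|n IH] e e0.
  near=> x; rewrite sum_tail0.
  have -> : - x < 0 by rewrite oppr_lt0; near: x; apply: nbhs_pinfty_gt; exact: num_real.
  by lra.
have e2 : 0 < e / 2 by lra.
near=> x.
have x0 : 0 < x by near: x; apply: nbhs_pinfty_gt; exact: num_real.
have H1 : 1 - e / 2 <= s n (- (2^-1 * x)).
  near: x; exact: half _ (IH _ e2).
have H2 : 1 - e / 2 < f (- (2^-1 * x)).
  near: x; exact: half _ (tail_cvg1 Q e2).
set h := 2^-1 * x in H1 H2.
have xh : x = 2 * h by rewrite /h; field.
apply: (@le_trans _ _ (s n (- h) * f (- h))).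
  have := sum_tail_le1 X n (- h); have := tail_le1 Q (- h) => t1 s1.
  have : (1 - s n (- h)) * (1 - f (- h)) >= 0 by rewrite mulr_ge0//; lra.
  by lra.
rewrite (sum_tailS Xindep XQ) -Rint_over -RintZ; last exact: bounded_over.
apply: Rint_le; [by apply: bounded_measurableZ; exact: bounded_over|exact: bounded_sum_tail|].
move=> y; rewrite overE; case: ltP => hy; last by rewrite mulr0 sum_tail_ge0.
by rewrite mulr1 sum_tail_noninc//; lra.
Unshelve. all: by end_near. Qed.

Variables (g : R -> R) (C : R).
Hypothesis g_ni : forall x y, x <= y -> g y <= g x.
Hypothesis g_gt0 : forall x, 0 < g x.
Hypothesis g_dom : exists A, 0 < A /\ \forall x \near +oo, g (2^-1 * x) <= A * g x.
Hypothesis fg : \forall x \near +oo, f x <= C * g x.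
Hypothesis f_long : forall h e, 0 < h -> 0 < e ->
  \forall x \near +oo, f (x - h) <= (1 + e) * f x.

Let C0 : 0 <= C. Proof. exact: dominating_constant_ge0 g_gt0 fg. Qed.

(** One big jump.  In [sum_tailS_upper] the first two terms give the main term by
    long-tailedness; the last two carry a factor tail Q h or s n h, small for
    large h, in front of a tail at x / 2, which is O(g x). *)
Lemma sum_tail_upper n e : 0 < e -> \forall x \near +oo, s n x <= n%:R * f x + e * g x.
Proof.
elim: n e => [|n IH] e e0.
  near=> x; rewrite sum_tail0 ltNge.
  have -> : 0 <= x by near: x; apply: nbhs_pinfty_ge; exact: num_real.
  by rewrite mul0r add0r mulr_ge0// ltW.
have [A [A0 gA]] := g_dom.
pose K := (n%:R * C + 1) * A.
have cC := C0; have A0' := ltW A0.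
have K0 : 0 <= K by rewrite mulr_ge0// addr_ge0// mulr_ge0//.
pose D := n.+1%:R * C + A + K + C * A.
have D0 : 0 <= D.
  apply: addr_ge0; last exact: mulr_ge0.
  by apply: addr_ge0 => //; apply: addr_ge0 => //; exact: mulr_ge0.
pose del := e / (D + 1).
have del0 : 0 < del by rewrite divr_gt0//; lra.
near (pinfty_nbhs R) => h.
have h0 : 0 < h by near: h; apply: nbhs_pinfty_gt; exact: num_real.
have fh : f h < del by near: h; exact: tail_cvg0.
have sh : s n h <= del by near: h; exact: sum_tail_cvg0.
have shift : x - h @[x --> +oo] --> +oo by exact: shift_cvgy.
near=> x.
have xh : 2 * h <= x by near: x; apply: nbhs_pinfty_ge; exact: num_real.
have g2 : g (2^-1 * x) <= A * g x by near: x.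
have gx := g_gt0 x.
have fx : f x <= C * g x by near: x.
have f2 : f (2^-1 * x) <= C * g (2^-1 * x) by near: x; exact: half _ fg.
have s2 : s n (2^-1 * x) <= n%:R * f (2^-1 * x) + 1 * g (2^-1 * x).
  by near: x; exact: half _ (IH _ ltr01).
have sxh : s n (x - h) <= n%:R * f (x - h) + del * g (x - h).
  by near: x; exact: shift _ (IH _ del0).
have fxh : f (x - h) <= (1 + del) * f x by near: x; exact: f_long.
have gxh : g (x - h) <= g (2^-1 * x) by apply: g_ni; lra.
apply: le_trans (sum_tailS_upper n h0 xh) _.
rewrite [x / 2]mulrC.
have n0 : 0 <= n%:R :> R by [].
have h1 : s n (2^-1 * x) <= K * g x.
  apply: (le_trans s2).
  have : n%:R * f (2^-1 * x) <= n%:R * (C * (A * g x)).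
    by rewrite ler_wpM2l// (le_trans f2)// ler_wpM2l.
  by rewrite /K; lra.
have h2 : s n (2^-1 * x) * f h <= K * g x * del.
  by apply: ler_pM => //; [exact: sum_tail_ge0|exact: tail_ge0|exact: ltW].
have h3 : s n h * f (2^-1 * x) <= del * (C * (A * g x)).
  apply: ler_pM => //; [exact: sum_tail_ge0|exact: tail_ge0|].
  by rewrite (le_trans f2)// ler_wpM2l.
have h4 : n.+1%:R * f (x - h) <= n.+1%:R * ((1 + del) * f x) by rewrite ler_wpM2l.
have h5 : n.+1%:R * f x * del <= n.+1%:R * (C * g x) * del.
  by rewrite ler_wpM2r ?(ltW del0)// ler_wpM2l.
have h6 : del * g (x - h) <= del * (A * g x).
  by rewrite ler_wpM2l ?(ltW del0)// (le_trans gxh).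
have h7 : del * D * g x <= e * g x.
  rewrite ler_wpM2r ?(ltW gx)// /del mulrAC ler_pdivrMr; last by lra.
  by rewrite ler_wpM2l ?(ltW e0)//; lra.
by rewrite /D -natr1 in h4 h5 h7 *; lra.
Unshelve. all: by end_near. Qed.

(** In [sum_tailS_lower] the factors in front of the tails at x + h tend to 1 as h
    grows, and long-tailedness replaces x + h by x. *)
Lemma sum_tail_lower n e : 0 < e -> \forall x \near +oo, n%:R * f x - e * g x <= s n x.
Proof.
elim: n e => [|n IH] e e0.
  near=> x; rewrite mul0r sub0r (le_trans _ (sum_tail_ge0 _ _ _))// oppr_le0.
  by rewrite mulr_ge0// ltW.
pose D := 3 * (n.+1%:R * C) + 1.
have cC := C0.
have D0 : 0 < D by rewrite ltr_wpDl// mulr_ge0// mulr_ge0.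
pose del : R := Num.min 4^-1 (e / D).
have del0 : 0 < del by rewrite lt_min invr_gt0 divr_gt0 ?ltr0n.
have del4 : del <= 4^-1 by rewrite ge_min lexx.
have d1 : 0 <= 1 - del by lra.
have d2 : 0 <= 1 - 2 * del by lra.
have d2' : 1 - 2 * del <= 1 by lra.
have delD : del * D <= e by rewrite -ler_pdivlMr// ge_min lexx orbT.
near (pinfty_nbhs R) => h.
have h0 : 0 < h by near: h; apply: nbhs_pinfty_gt; exact: num_real.
have fh : f h < del by near: h; exact: tail_cvg0.
have fNh : 1 - del < f (- h) by near: h; exact: tail_cvg1.
have sh : 1 - del <= s n (- h) by near: h; exact: sum_tail_cvg1.
have shift : x + h @[x --> +oo] --> +oo by exact: shift_cvgy.
near=> x.
have x0 : 0 <= x by near: x; apply: nbhs_pinfty_ge; exact: num_real.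
have gx := g_gt0 x.
have fx : f x <= C * g x by near: x.
have sxh : n%:R * f (x + h) - del * g (x + h) <= s n (x + h).
  by near: x; exact: shift _ (IH _ del0).
have fxh : f (x + h - h) <= (1 + del) * f (x + h).
  by near: x; exact: shift _ (f_long h0 del0).
rewrite addrK in fxh.
have gxh : g (x + h) <= g x by apply: g_ni; lra.
have fxh' : f (x + h) <= f h by apply: tail_noninc; lra.
have f0 := tail_ge0 Q x.
have n0 : 0 <= n%:R :> R by [].
apply: le_trans (sum_tailS_lower n h0 x0).
have k0 : (1 - del) * f x <= f (x + h).
  have : (1 - del) * f x <= (1 - del) * ((1 + del) * f (x + h)) by rewrite ler_wpM2l.
  have : 0 <= del * del * f (x + h) by rewrite !mulr_ge0 ?tail_ge0 ?ltW.
  by lra.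
have k1 : s n (x + h) * (1 - 2 * del) <= s n (x + h) * (f (- h) - f (x + h)).
  by rewrite ler_wpM2l ?sum_tail_ge0//; lra.
have k2 : (n%:R * f (x + h) - del * g (x + h)) * (1 - 2 * del) <= s n (x + h) * (1 - 2 * del).
  by rewrite ler_wpM2r.
have k3 : del * g (x + h) * (1 - 2 * del) <= del * g x.
  rewrite -[leRHS]mulr1; apply: ler_pM; rewrite ?mulr_ge0 ?(ltW del0) ?(ltW (g_gt0 _))//.
  by rewrite ler_wpM2l ?(ltW del0).
have k4 : n%:R * ((1 - del) * f x) * (1 - 2 * del) <= n%:R * f (x + h) * (1 - 2 * del).
  by rewrite ler_wpM2r// ler_wpM2l.
have k5 : (1 - del) * ((1 - del) * f x) <= s n (- h) * f (x + h).
  by apply: ler_pM => //; rewrite ?mulr_ge0.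
have k6 : n%:R * f x * (1 - 3 * del) <= n%:R * ((1 - del) * f x) * (1 - 2 * del).
  have : 0 <= n%:R * f x * (del * del) by rewrite !mulr_ge0// ltW.
  by lra.
have k7 : f x * (1 - 3 * del) <= (1 - del) * ((1 - del) * f x).
  have : 0 <= f x * (del * del) by rewrite !mulr_ge0// ltW.
  have : 0 <= f x * del by rewrite !mulr_ge0// ltW.
  by lra.
have k8 : 3 * del * (n.+1%:R * f x) <= 3 * del * (n.+1%:R * (C * g x)).
  by rewrite ler_wpM2l ?mulr_ge0 ?(ltW del0)// ler_wpM2l.
have k9 : del * D * g x <= e * g x by rewrite ler_wpM2r// ltW.
by rewrite /D -natr1 in k8 k9 *; lra.
Unshelve. all: by end_near. Qed.

End FixedNumberOfSteps.

(** * Random indices *)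

Section IndexLaw.
Context d (T : measurableType d) (R : realType) (P : probability T R).
Variable tau : {RV P >-> nat}.

Definition index_pr n : R := pr P [set w | tau w = n].

Lemma measurable_index (K : set nat) : measurable (tau @^-1` K).
Proof. exact: measurable_funPTI. Qed.

Lemma index_pr_ge0 n : 0 <= index_pr n. Proof. exact: pr_ge0. Qed.

Lemma measurable_lt_index N : measurable [set w | (tau w < N)%N].
Proof. exact: (measurable_index [set n | (n < N)%N]). Qed.

Lemma measurable_ge_index N : measurable [set w | (N <= tau w)%N].
Proof. exact: (measurable_index [set n | (N <= n)%N]). Qed.

Lemma index_pr_sum N :
  \sum_(0 <= n < N) index_pr n = 1 - pr P [set w | (N <= tau w)%N].
Proof.
elim: N => [|N IH].
  by rewrite big_nil (_ : [set _ | _] = setT) ?prT ?subrr//; apply/seteqP.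
rewrite big_nat_recr//= IH.
have -> : [set w | (N <= tau w)%N] = [set w | tau w = N] `|` [set w | (N < tau w)%N].
  apply/seteqP; split => w /=; first by rewrite leq_eqVlt => /predU1P[->|]; [left|right].
  by move=> [->//|/ltnW].
rewrite prU; first by rewrite /index_pr; ring.
- exact: (measurable_index [set N]).
- exact: measurable_ge_index.
- by rewrite disj_set2E; apply/eqP; rewrite -subset0 => w [/= ->]; rewrite ltnn.
Qed.

Lemma index_pr_sum_le1 N : \sum_(0 <= n < N) index_pr n <= 1.
Proof. by rewrite index_pr_sum lerBlDr lerDl pr_ge0. Qed.

End IndexLaw.

Section RandomIndex.
Context d (T : measurableType d) (R : realType) (P : probability T R).
Variables (X : nat -> {RV P >-> R}) (tau : {RV P >-> nat}).
Hypothesis tau_indep : independent_of_sequence tau X.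

Lemma past_sigma_of_sequence n : past X n `<=` sigma_of_sequence X.
Proof.
apply: sub_smallest2r; first exact: smallest_sigma_algebra.
by move=> A [i _ H]; exists i.
Qed.

Variable A : nat -> set T.
Hypothesis A_past : forall n, past X n (A n).

Let mA n : measurable (A n). Proof. exact: past_sub_measurable (@A_past n). Qed.

(** The events of the theorem, S_tau > x and M_tau > x, are of this form. *)
Definition at_index : set T := [set w | A (tau w) w].

Lemma measurable_at_index : measurable at_index.
Proof.
have -> : at_index = \bigcup_n ((tau @^-1` [set n]) `&` A n).
  apply/seteqP; split => w; first by move=> Aw; exists (tau w).
  by move=> [n _ [/= tn Aw]]; rewrite /at_index /= tn.
by apply: bigcup_measurable => n _; apply: measurableI => //; exact: measurable_index.
Qed.

(** Independence of tau and the steps, one value of tau at a time. *)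
Lemma at_index_below N :
  pr P (at_index `&` [set w | (tau w < N)%N]) = \sum_(0 <= n < N) index_pr tau n * pr P (A n).
Proof.
elim: N => [|N IH].
  rewrite big_nil (_ : _ `&` _ = set0) /pr ?measure0//.
  by apply/seteqP; split => // w [].
rewrite big_nat_recr//= -IH.
have -> : index_pr tau N * pr P (A N) = pr P ((tau @^-1` [set N]) `&` A N).
  have m1 : measurable [set w | tau w = N] by exact: (measurable_index tau [set N]).
  have m2 : measurable ((tau @^-1` [set N]) `&` A N) by exact: measurableI.
  apply: EFin_inj; rewrite EFinM -!prE//.
  by rewrite (tau_indep [set N] (past_sigma_of_sequence (@A_past N))).
rewrite -prU; first last.
- rewrite disj_set2E; apply/eqP; rewrite -subset0 => w [[_ /= tN] [/= tE _]].
  by rewrite tE ltnn in tN.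
- by apply: measurableI => //; exact: measurable_index.
- by apply: measurableI; [exact: measurable_at_index|exact: measurable_lt_index].
congr (pr P _); apply/seteqP; split => w.
  move=> [Aw /=]; rewrite ltnS leq_eqVlt => /predU1P[tE|tN]; [right|by left].
  by split => //=; rewrite -tE.
move=> [[Aw tN]|[/= tE Aw]]; first by split => //; exact: ltnW.
by split; [rewrite /at_index /= tE|rewrite /= tE].
Qed.

Lemma at_index_split N : pr P at_index =
  \sum_(0 <= n < N) index_pr tau n * pr P (A n) + pr P (at_index `&` [set w | (N <= tau w)%N]).
Proof.
rewrite -at_index_below -prU; first last.
- rewrite disj_set2E; apply/eqP; rewrite -subset0 => w [[_ /= tN] [_ /=]].
  by rewrite leqNgt tN.
- by apply: measurableI; [exact: measurable_at_index|exact: measurable_ge_index].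
- by apply: measurableI; [exact: measurable_at_index|exact: measurable_lt_index].
congr (pr P _); apply/seteqP; split => w; last by case=> -[].
by move=> Aw; case: (ltnP (tau w) N) => h; [left|right].
Qed.

Lemma at_index_upper N : pr P at_index <=
  \sum_(0 <= n < N) index_pr tau n * pr P (A n) + pr P [set w | (N <= tau w)%N].
Proof.
rewrite (at_index_split N) lerD2l; apply: pr_le => //.
- by apply: measurableI; [exact: measurable_at_index|exact: measurable_ge_index].
- exact: measurable_ge_index.
Qed.

(** Indices between N and a far level are counted one by one with the bound q;
    what lies beyond that level is negligible as tau is finite. *)
Lemma at_index_lower q K N : (K <= N)%N -> 0 <= q -> (forall n, (N <= n)%N -> q <= pr P (A n)) ->
  (forall e, 0 < e -> exists M, pr P [set w | (M <= tau w)%N] <= e) ->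
  \sum_(0 <= n < K) index_pr tau n * pr P (A n) +
    q * pr P [set w | (N <= tau w)%N] <= pr P at_index.
Proof.
move=> KN q0 qA tau_tail; rewrite (at_index_split K).
have mat := measurable_at_index.
have q1 : q <= 1 by apply: le_trans (qA N (leqnn N)) (pr_le1 _ (mA N)).
rewrite lerD2l; apply: (@le_trans _ _ (pr P (at_index `&` [set w | (N <= tau w)%N]))); last first.
  apply: pr_le; [apply: measurableI => //; exact: measurable_ge_index..|].
  by move=> w [Aw /= Nw]; split => //=; exact: leq_trans KN Nw.
apply/ler_addgt0Pr => e e0; have [M tM] := tau_tail e e0.
pose M' := maxn M N; have NM : (N <= M')%N by rewrite leq_maxr.
have tM' : pr P [set w | (M' <= tau w)%N] <= e.
  apply: le_trans tM; apply: pr_le; [exact: measurable_ge_index..|].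
  by move=> w /=; apply: leq_trans; rewrite leq_maxl.
have H1 : \sum_(N <= n < M') index_pr tau n * pr P (A n) <=
    pr P (at_index `&` [set w | (N <= tau w)%N]).
  have := at_index_split N; rewrite (at_index_split M') (big_cat_nat (leq0n N) NM)//=.
  by have := pr_ge0 P (at_index `&` [set w | (M' <= tau w)%N]); lra.
have H2 : q * \sum_(N <= n < M') index_pr tau n <= \sum_(N <= n < M') index_pr tau n * pr P (A n).
  rewrite big_distrr/= [leLHS]big_nat [leRHS]big_nat; apply: ler_sum => n /andP[Nn _].
  by rewrite mulrC ler_wpM2l ?index_pr_ge0// qA.
have H3 : \sum_(N <= n < M') index_pr tau n =
    pr P [set w | (N <= tau w)%N] - pr P [set w | (M' <= tau w)%N].
  by have := index_pr_sum tau M'; rewrite (big_cat_nat (leq0n N) NM)//= index_pr_sum; lra.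
have H4 : q * pr P [set w | (M' <= tau w)%N] <= 1 * e by apply: ler_pM => //; exact: pr_ge0.
by rewrite H3 mulrBr in H2; lra.
Qed.


End RandomIndex.

Section IndexMean.
Context d (T : measurableType d) (R : realType) (P : probability T R).
Variable tau : {RV P >-> nat}.
Local Notation tauR := ((@nat_to_real R \o tau) : {RV P >-> R}).
Hypothesis tau_mean : ('E_P[tauR] < +oo)%E.

Lemma index_integrable : P.-integrable [set: T] (EFin \o tauR).
Proof.
apply/integrableP; split; first exact/measurable_EFinP.
move: tau_mean; rewrite expectation_def; apply: le_lt_trans.
by under eq_integral do rewrite /= ger0_norm//.
Qed.

Lemma index_mean : fine 'E_P[tauR] = \int[P]_w tauR w.
Proof. by rewrite expectation_def. Qed.

Let below N (w : T) : R := if (tau w < N)%N then (tau w)%:R else 0.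

Let belowS N w : below N.+1 w = below N w + N%:R * \1_([set w | tau w = N]) w.
Proof.
rewrite /below indicE ltnS leq_eqVlt; case: eqVneq => [tN|tN] /=.
  by rewrite -tN ltnn add0r mem_set// mulr1.
by rewrite memNset ?mulr0 ?addr0//=; apply/eqP.
Qed.

Let below_integral N : bounded_measurable (below N) /\
  \int[P]_w below N w = \sum_(0 <= n < N) n%:R * index_pr tau n.
Proof.
elim: N => [|N [bN iN]].
  rewrite big_nil; split; first exact: bounded_measurable_cst.
  exact: (Rint_cst P 0).
have mN : measurable [set w | tau w = N] by exact: (measurable_index tau [set N]).
have b1 : bounded_measurable (\1_([set w | tau w = N]) : T -> R) by exact: bounded_measurable_indic.
have b2 := bounded_measurableZ N%:R b1.
have -> : below N.+1 = fun w => below N w + N%:R * \1_([set w | tau w = N]) w.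
  by apply/funext => w; rewrite belowS.
split; first exact: bounded_measurableD.
by rewrite RintD// RintZ// iN Rint_indic// big_nat_recr.
Qed.

Let below_le N w : 0 <= below N w <= (tau w)%:R.
Proof. by rewrite /below; case: ifP => _; rewrite lexx ?andbT ?ler0n. Qed.

Lemma partial_mean_le N : \sum_(0 <= n < N) n%:R * index_pr tau n <= fine 'E_P[tauR].
Proof.
have [bN <-] := below_integral N; rewrite index_mean.
apply: le_Rintegral => //; [exact: bounded_measurable_integrable|exact: index_integrable|].
by move=> w _; have /andP[] := below_le N w.
Qed.

(** Dominated convergence of the truncated index to tau. *)
Lemma partial_mean_ge e : 0 < e -> exists K, (0 < K)%N /\
  fine 'E_P[tauR] - e <= \sum_(0 <= n < K) n%:R * index_pr tau n.
Proof.
move=> e0.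
have fin : (\int[P]_w (tauR w)%:E)%E \is a fin_num.
  by apply: integrable_fin_num => //; exact: index_integrable.
have cv : (\int[P]_w (below n w)%:E)%E @[n --> \oo] --> (\int[P]_w (tauR w)%:E)%E.
  have [] // := @dominated_convergence _ _ _ P setT measurableT
    (fun n w => (below n w)%:E) (EFin \o tauR) (EFin \o tauR).
  - by move=> n; have [[mb _] _] := below_integral n; exact/measurable_EFinP.
  - exact/measurable_EFinP.
  - apply: aeW => w _; apply: cvg_near_cst; near=> n.
    rewrite /below; have -> : (tau w < n)%N by near: n; exact: nbhs_infty_gt.
    by [].
  - exact: index_integrable.
  - apply: aeW => w n _ /=; rewrite lee_fin; have /andP[b0 b1] := below_le n w.
    by rewrite ger0_norm.
have lt : fine 'E_P[tauR] - e < fine (\int[P]_w (tauR w)%:E)%E.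
  by rewrite index_mean /Rintegral; lra.
move: cv; rewrite -(fineK fin) => /fine_cvgP[_ /cvgr_gt/(_ _ lt)[N _ /(_ N.+1 (leqnSn N))/= HN]].
exists N.+1; split => //; have [_ <-] := below_integral N.+1; exact: ltW.
Unshelve. all: by end_near. Qed.

Lemma mean_beyond K rho N : 
  fine 'E_P[tauR] - rho <= \sum_(0 <= n < K) n%:R * index_pr tau n -> 0 <= rho ->
  \sum_(0 <= n < N) (if (n < K)%N then 0 else n%:R * index_pr tau n) <= rho.
Proof.
move=> H rho0; have [NK|/ltnW KN] := leqP N K.
  rewrite big_nat big1// => n /andP[_ nN]; rewrite (leq_trans nN NK)//.
have := partial_mean_le N; rewrite (big_cat_nat (leq0n K) KN)//= => H1.
rewrite [leLHS](big_cat_nat (leq0n K) KN)//= big_nat big1 ?add0r; last by move=> n /andP[_ ->].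
have -> : \sum_(K <= n < N) (if (n < K)%N then 0 else n%:R * index_pr tau n) =
  \sum_(K <= n < N) n%:R * index_pr tau n.
  by apply: eq_big_nat => n /andP[Kn _]; rewrite ltnNge Kn.
by move: H H1; set a := \sum_(0 <= n < K) _; set b := \sum_(K <= n < N) _; lra.
Qed.

Lemma tail_index y : 0 <= y ->
  tail (distribution P tauR) y = pr P [set w | ((Num.truncn y).+1 <= tau w)%N].
Proof.
move=> y0; rewrite /tail /distribution /pushforward /pr; congr (fine (P _)).
apply/seteqP; split => w; rewrite /= in_itv/= andbT /nat_to_real.
  by rewrite truncn_lt_nat.
by rewrite truncn_lt_nat.
Qed.

End IndexMean.

(** * Randomly stopped sums *)

Section RandomSums.
Context d (T : measurableType d) (R : realType) (P : probability T R).
Variables (X : nat -> {RV P >-> R}) (Q : probability R R) (tau : {RV P >-> nat}).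
Local Notation tauR := ((@nat_to_real R \o tau) : {RV P >-> R}).
Local Notation G := (distribution P tauR : probability R R).
Hypothesis Xindep : mutually_independent X.
Hypothesis XQ : forall n B, measurable B -> P (X n @^-1` B) = Q B.
Hypothesis Qint : Q.-integrable [set: R] (EFin : R -> \bar R).
Local Notation mu := (\int[Q]_y y).
Hypothesis mu_gt0 : 0 < mu.
Hypothesis tau_mean : ('E_P[tauR] < +oo)%E.
Hypothesis tau_indep : independent_of_sequence tau X.
Hypothesis irv : intermediate_regularly_varying G.
Local Notation f := (tail Q).
Local Notation g := (tail G).
Local Notation Etau := (fine 'E_P[tauR]).
Local Notation s n x := (sum_tail X n x).
Variable C : R.
Hypothesis fg : \forall x \near +oo, f x <= C * g x.
Hypothesis f_long : forall h e, 0 < h -> 0 < e ->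
  \forall x \near +oo, f (x - h) <= (1 + e) * f x.

Let g_gt0 x : 0 < g x. Proof. by have [] := irv. Qed.

Let g_ni x y : x <= y -> g y <= g x. Proof. exact: tail_noninc. Qed.

Let g_dom : exists A, 0 < A /\ \forall x \near +oo, g (2^-1 * x) <= A * g x.
Proof. by apply: (irv_dominated irv); rewrite invr_gt0. Qed.

Let C_ge0 : 0 <= C. Proof. exact: dominating_constant_ge0 g_gt0 fg. Qed.

Let Etau_ge0 : 0 <= Etau.
Proof. by have := partial_mean_le tau_mean 0; rewrite big_nil. Qed.

Definition target x := Etau * f x + g (x / mu).

(** The level is lowered by the constant A lost in Ottaviani's inequality. *)
Lemma small_index_upper A e K : 0 < A -> 0 < e ->
  \forall x \near +oo, forall n, (n < K)%N -> s n (x - A) <= n%:R * f x + e * g x.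
Proof.
move=> A0 e0; elim: K => [|K IH]; first by near=> x.
have [D [D0 gD]] := g_dom.
have e1 : 0 < e / (2 * D) by rewrite divr_gt0// mulr_gt0.
have KC : 0 <= K%:R * C by rewrite mulr_ge0// C_ge0.
have [e2 [e20 e2K]] : exists e2, 0 < e2 /\ e2 * (K%:R * C) <= e / 2.
  have KC1 : 0 < 2 * (K%:R * C + 1) by lra.
  exists (e / (2 * (K%:R * C + 1))); split; first by rewrite divr_gt0.
  rewrite mulrAC ler_pdivrMr//; have : e * (K%:R * C) <= e * (K%:R * C + 1).
    by rewrite ler_wpM2l ?ltW//; lra.
  by lra.
have H1 := shift_cvgy (- A) (sum_tail_upper Xindep XQ g_ni g_gt0 g_dom fg f_long K e1).
suff key : \forall x \near +oo, s K (x - A) <= K%:R * f x + e * g x.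
  near=> x => n; rewrite ltnS leq_eqVlt => /predU1P[->|nK]; first by near: x.
  by move: n nK; near: x.
near=> x.
have h1 : s K (x - A) <= K%:R * f (x - A) + e / (2 * D) * g (x - A) by near: x.
have h2 : f (x - A) <= (1 + e2) * f x by near: x; exact: f_long.
have h3 : g (2^-1 * x) <= D * g x by near: x.
have h4 : f x <= C * g x by near: x.
have x2A : 2 * A <= x by near: x; apply: nbhs_pinfty_ge; exact: num_real.
have h5 : g (x - A) <= D * g x by apply: le_trans h3; apply: g_ni; lra.
have gx := g_gt0 x.
have h6 : e / (2 * D) * g (x - A) <= e / 2 * g x.
  have -> : e / 2 * g x = e / (2 * D) * (D * g x) by field; rewrite lt0r_neq0.
  by rewrite ler_wpM2l// ltW.
have h8 : K%:R * f (x - A) <= K%:R * ((1 + e2) * f x) by rewrite ler_wpM2l.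
have h9 : K%:R * (e2 * f x) <= K%:R * (e2 * (C * g x)).
  by rewrite ler_wpM2l// ler_wpM2l// ltW.
have h10 : e2 * (K%:R * C) * g x <= e / 2 * g x.
  by rewrite ler_wpM2r ?(ltW gx).
by lra.
Unshelve. all: by end_near. Qed.

Lemma small_index_lower e K : 0 < e ->
  \forall x \near +oo, forall n, (n < K)%N -> n%:R * f x - e * g x <= s n x.
Proof.
move=> e0; elim: K => [|K IH]; first by near=> x.
have H1 := sum_tail_lower Xindep XQ g_ni g_gt0 fg f_long K e0.
near=> x => n; rewrite ltnS leq_eqVlt => /predU1P[->|nK]; first by near: x.
by move: n nK; near: x.
Unshelve. all: by end_near. Qed.

(** Let c = m (1 + t) / (2 t) for the mean m of the steps.  As c > m, the walk
    S_n - n c has negative drift; as n c <= (1 + t) x / 2 for n <= t x / m, the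
    sum can exceed x only if this walk exceeds a fixed fraction of x, and
    [wait_linear_bound] applies. *)
Lemma large_index_upper t : 0 < t -> t < 1 -> forall A, 0 < A ->
  exists B, 0 <= B /\ \forall x \near +oo, forall n, (0 < n)%N ->
    n%:R <= t * (x / mu) -> s n (x - A) <= B * n%:R * g x.
Proof.
move=> t0 t1 A A0.
pose c := mu * (1 + t) / (2 * t).
have cmu : 1 * mu + (- c) < 0.
  rewrite subr_lt0 mul1r /c ltr_pdivlMr ?mulr_gt0//.
  by rewrite ltr_pM2l//; lra.
(* x - n c is at least 2 eps x; half of it absorbs the shift A. *)
pose eps := (1 - t) / 4.
have eps0 : 0 < eps by rewrite /eps; lra.
have [A3 [A30 gA3]] : exists A, 0 < A /\ \forall x \near +oo, g (3^-1 * x) <= A * g x.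
  by apply: (irv_dominated irv); rewrite invr_gt0.
have g3 : \forall x \near +oo, g x <= A3 * g (3 * x).
  have three : (0 : R) < 3 by [].
  have H : \forall x \near +oo, g (3^-1 * (3 * x)) <= A3 * g (3 * x) := scale_cvgy three gA3.
  by apply: filterS H => x; rewrite mulrA mulVf// mul1r.
have tl : \forall x \near +oo, tail (affine_law Q 1 (- c)) x <= C * g x.
  near=> x; apply: (@le_trans _ _ (f x)); last by near: x.
  have c0 : 0 <= c by rewrite divr_ge0// ?mulr_ge0// ?ltW// ?addr_gt0// mulr_gt0.
  change (pr Q (affine 1 (- c) @^-1` `]x, +oo[%classic) <= pr Q `]x, +oo[%classic).
  apply: pr_le => //.
    by rewrite -[Y in measurable Y]setTI; exact: measurable_affine.
  by move=> y /=; rewrite !in_itv/= !andbT /affine mul1r; lra.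
have [B [B0 HB]] := wait_linear_bound (affine_wait_sup_lt1 Xindep XQ Qint cmu) g_ni g_gt0 g3 tl.
have [D [D0 gD]] := irv_dominated irv eps0.
exists (B * D); split; first by rewrite mulr_ge0// ltW.
have HB' := scale_cvgy eps0 HB.
have walkE n y : [set w | y < 1 * partial_sum X n w + n%:R * - c] =
    [set w | y + n%:R * c < partial_sum X n w].
  by apply/seteqP; split => w /=; lra.
near=> x => n n0 nx.
have x0 : 0 <= x by near: x; apply: nbhs_pinfty_ge; exact: num_real.
have xA : A / eps <= x by near: x; apply: nbhs_pinfty_ge; exact: num_real.
have nc : n%:R * c <= (1 + t) / 2 * x.
  have -> : (1 + t) / 2 * x = t * (x / mu) * c.
    by rewrite /c; field; rewrite !lt0r_neq0.
  by rewrite ler_wpM2r// divr_ge0// ?mulr_ge0// ?ltW// ?addr_gt0// mulr_gt0.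
have epsx : A <= eps * x by rewrite mulrC -ler_pdivrMr.
have w1 : s n (x - A) <= wait (affine_law Q 1 (- c)) n (eps * x).
  apply: le_trans (affine_sum_le_wait Xindep XQ 1 (- c) n (eps * x)).
  apply: pr_le.
  - exact: measurable_sum_gt.
  - by rewrite walkE; exact: measurable_sum_gt.
  - by rewrite walkE => w /=; rewrite /eps in epsx *; lra.
have w2 : wait (affine_law Q 1 (- c)) n (eps * x) <= B * n%:R * g (eps * x).
  by move: n n0 {nx nc w1}; near: x.
have g1 : g (eps * x) <= D * g x by near: x.
apply: (le_trans w1); apply: (le_trans w2).
have -> : B * D * n%:R * g x = B * n%:R * (D * g x) by ring.
by rewrite ler_wpM2l// mulr_ge0.
Unshelve. all: by end_near. Qed.

(** Tightness of the walk with steps - X. *)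
Lemma sum_tail_bounded_below e : 0 < e ->
  exists A, 0 < A /\ forall n, 1 - e <= s n (- A).
Proof.
move=> e0.
have dr : (-1) * mu + 0 < 0 by rewrite addr0 mulN1r oppr_lt0.
have H := affine_sum_tight Xindep XQ Qint dr e0.
near (pinfty_nbhs R) => z.
have z0 : 0 < z by near: z; apply: nbhs_pinfty_gt; exact: num_real.
exists (z + 1); split; first by lra.
move=> n.
have Hz : pr P [set w | z < -1 * partial_sum X n w + n%:R * 0] <= e by move: n; near: z.
have m1 : measurable [set w | - (z + 1) < partial_sum X n w] by exact: measurable_sum_gt.
rewrite /sum_tail lerBlDl -lerBlDr -prC//.
apply: le_trans Hz; apply: pr_le; first exact: measurableC.
  have -> : [set w | z < -1 * partial_sum X n w + n%:R * 0] =
      ~` [set w | - z <= partial_sum X n w].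
    by apply/seteqP; split => w /=; [move=> ? /=|move/negP; rewrite -ltNge]; lra.
  apply: measurableC.
  have -> : [set w | - z <= partial_sum X n w] = partial_sum X n @^-1` `[- z, +oo[.
    by apply/seteqP; split => w /=; rewrite in_itv/= andbT.
  by rewrite -[Y in measurable Y]setTI; exact: measurable_partial_sum.
by move=> w /= /negP; rewrite -leNgt; lra.
Unshelve. all: by end_near. Qed.

(** With c = m (1 + t) / 2 < m, the walk n c - S_n has negative drift, hence is
    unlikely to exceed n c - x, which grows linearly in x when n >= x / (m t). *)
Lemma sum_tail_law_of_large_numbers t e : 0 < t -> t < 1 -> 0 < e ->
  \forall x \near +oo, forall n, x / (mu * t) <= n%:R -> 1 - e <= s n x.
Proof.
move=> t0 t1 e0.
pose c := mu * (1 + t) / 2.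
have dr : (-1) * mu + c < 0.
  have : mu * t < mu * 1 by rewrite ltr_pM2l.
  by rewrite /c; lra.
have H := affine_sum_tight Xindep XQ Qint dr e0.
(* n c - x is at least 2 k x; the margin between k x and 2 k x turns the strict
   inequality of the tail into the weak one of its complement. *)
pose k := (1 - t) / (4 * t).
have k0 : 0 < k by rewrite divr_gt0 ?mulr_gt0//; lra.
have H' := scale_cvgy k0 H.
near=> x => n nx.
have x0 : 0 < x by near: x; apply: nbhs_pinfty_gt; exact: num_real.
have Hz : pr P [set w | k * x < -1 * partial_sum X n w + n%:R * c] <= e.
  by move: n {nx}; near: x.
have kx : 2 * (k * x) <= n%:R * c - x.
  have : x / (mu * t) * c <= n%:R * c.
    by rewrite ler_wpM2r// divr_ge0// mulr_ge0 ?ltW// addr_gt0.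
  have -> : x / (mu * t) * c = 2 * (k * x) + x.
    by rewrite /c /k; field; rewrite !lt0r_neq0.
  by lra.
have kx0 : 0 < k * x by rewrite mulr_gt0.
have m1 : measurable [set w | x < partial_sum X n w] by exact: measurable_sum_gt.
rewrite /sum_tail lerBlDl -lerBlDr -prC//.
apply: le_trans Hz; apply: pr_le; first exact: measurableC.
  have -> : [set w | k * x < -1 * partial_sum X n w + n%:R * c] =
      ~` [set w | n%:R * c - k * x <= partial_sum X n w].
    by apply/seteqP; split => w /=; [move=> ? /=|move/negP; rewrite -ltNge]; lra.
  apply: measurableC.
  have -> : [set w | n%:R * c - k * x <= partial_sum X n w] =
      partial_sum X n @^-1` `[n%:R * c - k * x, +oo[.
    by apply/seteqP; split => w /=; rewrite in_itv/= andbT.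
  by rewrite -[Y in measurable Y]setTI; exact: measurable_partial_sum.
by move=> w /= /negP; rewrite -leNgt; lra.
Unshelve. all: by end_near. Qed.

Let g_scaled : exists C1, 0 < C1 /\ \forall x \near +oo, g x <= C1 * g (x / mu).
Proof.
have [C1 [C10 HC]] := irv_dominated irv mu_gt0; exists C1; split => //.
have mui : 0 < mu^-1 by rewrite invr_gt0.
have H : \forall x \near +oo, g (mu * (mu^-1 * x)) <= C1 * g (mu^-1 * x) := scale_cvgy mui HC.
by apply: filterS H => x; rewrite mulrA mulfV ?lt0r_neq0// mul1r [mu^-1 * x]mulrC.
Qed.

Let past_crossed_all x n : past X n (crossed X n x).
Proof. exact: past_crossed. Qed.

Let past_sum_gt x n : past X n [set w | x < partial_sum X n w].
Proof. by apply: past_gt; exact: past_partial_sum. Qed.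

(** Indices below K give at most E(tau) times the tail of a step plus an error e1;
    those between K and t x / m contribute the mean of tau beyond K, at most rho,
    times the constant of [large_index_upper]; for the others the tail of tau at
    t x / m is used.  The constants e1 and rho are chosen small relative to the
    ratio C1 between g x and g (x / m). *)
Lemma max_at_index_upper eta : 0 < eta -> \forall x \near +oo,
  pr P (at_index tau (fun n => crossed X n x)) <= (1 + eta) * (1 + eta) * target x.
Proof.
move=> eta0; have eta1 : 0 <= 1 + eta by lra.
have collect (u v : R) : 0 <= u ->
    (1 + eta) * (u + eta / 2 * v + eta / 2 * v) + (1 + eta) * v <=
    (1 + eta) * (1 + eta) * (u + v).
  move=> u0; have : 0 <= (1 + eta) * eta * u by rewrite !mulr_ge0// ltW.
  by lra.
have [t [t0 [t1 Ht]]] := irv_near irv eta0.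
have e00 : 0 < eta / (1 + eta) by rewrite divr_gt0//; lra.
have [A [A0 HA]] := sum_tail_bounded_below e00.
have [B [B0 HB]] := large_index_upper t0 t1 A0.
have [C1 [C10 HC]] := g_scaled.
have [e1 [e10 e1C]] : exists e1, 0 < e1 /\ e1 * C1 <= eta / 2.
  by exists (eta / 2 / C1); rewrite divfK ?lt0r_neq0//; split => //; rewrite !divr_gt0.
have [rho [rho0 rhoC]] : exists rho, 0 < rho /\ B * rho * C1 <= eta / 2.
  have BC : 0 < (B + 1) * C1 by rewrite mulr_gt0//; lra.
  exists (eta / 2 / ((B + 1) * C1)); split; first by rewrite !divr_gt0.
  rewrite mulrAC mulrA ler_pdivrMr// mulrC ler_wpM2l//; last by rewrite ler_pM2r//; lra.
  by rewrite divr_ge0// ltW.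
have [K [_ HK]] := partial_mean_ge tau_mean rho0.
have mui : 0 < mu^-1 by rewrite invr_gt0.
have HS := small_index_upper K A0 e10.
have Ht' : \forall x \near +oo,
    g (t * (mu^-1 * x)) <= (1 + eta) * g (mu^-1 * x) := scale_cvgy mui Ht.
near=> x.
have x0 : 0 <= x by near: x; apply: nbhs_pinfty_ge; exact: num_real.
have Hs : forall n, (n < K)%N -> s n (x - A) <= n%:R * f x + e1 * g x by near: x.
have Hl : forall n, (0 < n)%N -> n%:R <= t * (x / mu) -> s n (x - A) <= B * n%:R * g x by near: x.
have Htx : g (t * (x / mu)) <= (1 + eta) * g (x / mu) by rewrite [x / mu]mulrC; near: x.
have Hg : g x <= C1 * g (x / mu) by near: x.
have y0 : 0 <= t * (x / mu) by rewrite mulr_ge0 ?divr_ge0// ltW.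
pose N := (Num.truncn (t * (x / mu))).+1.
have gx := g_gt0 x; have gmx := g_gt0 (x / mu).
have fx := tail_ge0 Q x.
apply: le_trans (at_index_upper tau_indep (past_crossed_all x) N) _.
rewrite -tail_index//.
pose b n := if (n < K)%N then 0 else n%:R * index_pr tau n.
have step n : (n < N)%N -> index_pr tau n * pr P (crossed X n x) <=
    (1 + eta) * (f x * (n%:R * index_pr tau n) + e1 * g x * index_pr tau n + B * g x * b n).
  move=> nN; have p0 := index_pr_ge0 tau n.
  have c1 : pr P (crossed X n x) <= (1 + eta) * s n (x - A) by exact: (crossed_le Xindep XQ).
  have c2 : index_pr tau n * s n (x - A) <=
      f x * (n%:R * index_pr tau n) + e1 * g x * index_pr tau n + B * g x * b n.
    rewrite /b; case: ltnP => nK.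
      apply: le_trans (ler_wpM2l p0 (Hs n nK)) _.
      by rewrite mulr0 addr0 le_eqVlt; apply/orP; left; apply/eqP; ring.
    have [->|n0] := posnP n.
      rewrite sum_tail0 subr_lt0 (_ : x < A = false).
        by rewrite mulr0 !mul0r !mulr0 add0r addr0 mulr_ge0 ?mulr_ge0 ?index_pr_ge0// ltW.
      by apply/negbTE; rewrite -leNgt; near: x; apply: nbhs_pinfty_ge; exact: num_real.
    have nx : n%:R <= t * (x / mu).
      by apply: le_trans (_ : (Num.truncn (t * (x / mu)))%:R <= _); rewrite ?ler_nat// truncn_le.
    apply: le_trans (ler_wpM2l p0 (Hl n n0 nx)) _.
    have -> : index_pr tau n * (B * n%:R * g x) = B * g x * (n%:R * index_pr tau n) by ring.
    by rewrite lerDr addr_ge0// !mulr_ge0// ltW.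
  apply: le_trans (ler_wpM2l p0 c1) _.
  by rewrite mulrCA ler_wpM2l.
have S1 := partial_mean_le tau_mean N.
have S2 := index_pr_sum_le1 tau N.
have S3 : \sum_(0 <= n < N) b n <= rho := mean_beyond tau_mean N HK (ltW rho0).
have Sum : \sum_(0 <= n < N) index_pr tau n * pr P (crossed X n x) <=
   (1 + eta) * (f x * (\sum_(0 <= n < N) n%:R * index_pr tau n) +
     e1 * g x * (\sum_(0 <= n < N) index_pr tau n) + B * g x * \sum_(0 <= n < N) b n).
  rewrite !big_distrr/= -!big_split/= big_distrr/= [leLHS]big_nat [leRHS]big_nat.
  by apply: ler_sum => n /andP[_ nN]; exact: step.
have r1 : f x * (\sum_(0 <= n < N) n%:R * index_pr tau n) <= f x * Etau by rewrite ler_wpM2l.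
have r2 : e1 * g x * (\sum_(0 <= n < N) index_pr tau n) <= eta / 2 * g (x / mu).
  apply: (@le_trans _ _ (e1 * g x * 1)); first by rewrite ler_wpM2l// mulr_ge0// ltW.
  rewrite mulr1; apply: (@le_trans _ _ (e1 * (C1 * g (x / mu)))); first by rewrite ler_wpM2l// ltW.
  by rewrite mulrA ler_wpM2r// ltW.
have r3 : B * g x * (\sum_(0 <= n < N) b n) <= eta / 2 * g (x / mu).
  apply: (@le_trans _ _ (B * g x * rho)); first by rewrite ler_wpM2l// mulr_ge0// ltW.
  rewrite mulrAC; apply: (@le_trans _ _ (B * rho * (C1 * g (x / mu)))).
    by rewrite ler_wpM2l// mulr_ge0// ltW.
  by rewrite mulrA ler_wpM2r// ltW.
apply: le_trans (collect _ _ (mulr_ge0 Etau_ge0 fx)); apply: lerD => //.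
by apply: (le_trans Sum); rewrite ler_wpM2l// [Etau * _]mulrC !lerD.
Unshelve. all: by end_near. Qed.

Lemma tau_tail_cvg0 e : 0 < e -> exists M, pr P [set w | (M <= tau w)%N] <= e.
Proof.
move=> e0; near (pinfty_nbhs R) => y.
have y0 : 0 <= y by near: y; apply: nbhs_pinfty_ge; exact: num_real.
exists (Num.truncn y).+1; rewrite -tail_index//; apply: ltW.
by near: y; exact: tail_cvg0.
Unshelve. all: by end_near. Qed.

(** Indices below K, chosen to capture all but rho of the mean of tau, give the
    first term of the target; indices above x / (m t), where the sum exceeds x
    with probability at least 1 - eta, give the second. *)
Lemma sum_at_index_lower eta : 0 < eta -> eta < 1 -> \forall x \near +oo,
  (1 - 3 * eta) * target x <= pr P (at_index tau (fun n => [set w | x < partial_sum X n w])).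
Proof.
move=> eta0 eta1; have q0 : 0 <= 1 - eta by lra.
have shrink (u v : R) : 0 <= u -> v <= u -> u <= (1 + eta) * v ->
    (1 - 2 * eta) * u <= (1 - eta) * v.
  move=> u0 vu uv.
  have : (1 - eta) * u <= (1 - eta) * ((1 + eta) * v) by rewrite ler_wpM2l.
  have : (1 - eta) * eta * v <= (1 - eta) * eta * u by rewrite ler_wpM2l// mulr_ge0// ltW.
  have : 0 <= eta * eta * u by rewrite !mulr_ge0// ltW.
  by lra.
have collect (u v r a b z l : R) : 0 <= u -> u - r <= a -> b <= eta / 2 * v ->
    r <= eta / 2 * v -> a - b <= z -> (1 - 2 * eta) * v <= l ->
    (1 - 3 * eta) * (u + v) <= z + l.
  move=> u0 ? ? ? ? ?; have : 0 <= eta * u by rewrite mulr_ge0// ltW.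
  by lra.
have [t [t0 [t1 Ht]]] := irv_near irv eta0.
have HL := sum_tail_law_of_large_numbers t0 t1 eta0.
have [C1 [C10 HC]] := g_scaled.
have [e1 [e10 e1C]] : exists e1, 0 < e1 /\ e1 * C1 <= eta / 2.
  by exists (eta / 2 / C1); rewrite divfK ?lt0r_neq0//; split => //; rewrite !divr_gt0.
have [rho [rho0 rhoC]] : exists rho, 0 < rho /\ rho * C * C1 <= eta / 2.
  have BC : 0 < (C + 1) * C1 by rewrite mulr_gt0//; have := C_ge0; lra.
  exists (eta / 2 / ((C + 1) * C1)); split; first by rewrite !divr_gt0.
  rewrite -mulrA mulrAC ler_pdivrMr// ler_wpM2l//; last by rewrite ler_pM2r//; lra.
  by rewrite divr_ge0// ltW.
have [K [_ HK]] := partial_mean_ge tau_mean rho0.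
have HS := small_index_lower K e10.
have mt : 0 < (mu * t)^-1 by rewrite invr_gt0 mulr_gt0.
have Ht' : \forall x \near +oo, g (t * ((mu * t)^-1 * x)) <= (1 + eta) * g ((mu * t)^-1 * x)
  := scale_cvgy mt Ht.
near=> x.
have x0 : 0 <= x by near: x; apply: nbhs_pinfty_ge; exact: num_real.
have Hs : forall n, (n < K)%N -> n%:R * f x - e1 * g x <= s n x by near: x.
have Hl : forall n, x / (mu * t) <= n%:R -> 1 - eta <= s n x by near: x.
have Htx : g (x / mu) <= (1 + eta) * g (x / (mu * t)).
  have -> : x / mu = t * ((mu * t)^-1 * x) by field; rewrite !lt0r_neq0.
  by rewrite [x / (mu * t)]mulrC; near: x.
have Hg : g x <= C1 * g (x / mu) by near: x.
have Hf : f x <= C * g x by near: x.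
have xK : K%:R <= x / (mu * t).
  by rewrite ler_pdivlMr ?mulr_gt0//; near: x; apply: nbhs_pinfty_ge; exact: num_real.
pose N := (Num.truncn (x / (mu * t))).+1.
have y0 : 0 <= x / (mu * t) by rewrite divr_ge0// mulr_ge0// ltW.
have KN : (K <= N)%N by rewrite -(ler_nat R) (le_trans xK)// ltW// truncnS_gt.
have gx := g_gt0 x; have gmx := g_gt0 (x / mu).
have fx := tail_ge0 Q x.
have qN n : (N <= n)%N -> 1 - eta <= pr P [set w | x < partial_sum X n w].
  move=> Nn; apply: Hl; apply: le_trans (_ : N%:R <= _); last by rewrite ler_nat.
  by rewrite ltW// truncnS_gt.
have := at_index_lower tau_indep (past_sum_gt x) KN q0 qN tau_tail_cvg0.
apply: le_trans; rewrite -tail_index//.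
have Sum : f x * (\sum_(0 <= n < K) n%:R * index_pr tau n) -
   e1 * g x * (\sum_(0 <= n < K) index_pr tau n) <=
   \sum_(0 <= n < K) index_pr tau n * pr P [set w | x < partial_sum X n w].
  rewrite !big_distrr/= -sumrB [leLHS]big_nat [leRHS]big_nat.
  apply: ler_sum => n /andP[_ nK].
  apply: le_trans (ler_wpM2l (index_pr_ge0 tau n) (Hs n nK)).
  by rewrite le_eqVlt; apply/orP; left; apply/eqP; ring.
have S2 := index_pr_sum_le1 tau K.
have r1 : Etau * f x - f x * rho <= f x * (\sum_(0 <= n < K) n%:R * index_pr tau n).
  by rewrite [Etau * _]mulrC -mulrBr ler_wpM2l.
have r2 : e1 * g x * (\sum_(0 <= n < K) index_pr tau n) <= eta / 2 * g (x / mu).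
  apply: (@le_trans _ _ (e1 * g x * 1)); first by rewrite ler_wpM2l// mulr_ge0// ltW.
  rewrite mulr1; apply: (@le_trans _ _ (e1 * (C1 * g (x / mu)))); first by rewrite ler_wpM2l// ltW.
  by rewrite mulrA ler_wpM2r// ltW.
have r3 : f x * rho <= eta / 2 * g (x / mu).
  apply: (@le_trans _ _ (rho * (C * (C1 * g (x / mu))))).
    by rewrite [leLHS]mulrC ler_wpM2l ?(ltW rho0)// (le_trans Hf)// ler_wpM2l// C_ge0.
  by rewrite !mulrA ler_wpM2r// ltW.
apply: (collect _ _ _ _ _ _ _ _ r1 r2 r3 Sum); first by rewrite mulr_ge0.
apply: shrink => //; first exact: ltW.
by apply: g_ni; rewrite ler_wpM2l// lef_pV2 ?posrE ?mulr_gt0// ler_piMr// ltW.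
Unshelve. all: by end_near. Qed.

End RandomSums.


Lemma asymp_equiv_of_sandwich (R : realType) (u v : R -> R) :
  (\forall x \near +oo, 0 < v x) ->
  (forall e, 0 < e -> \forall x \near +oo, (1 - e) * v x <= u x <= (1 + e) * v x) ->
  asymp_equiv u v.
Proof.
move=> v0 H; apply/cvgrPdist_le => e e0; have He := H e e0.
near=> x.
have vx : 0 < v x by near: x.
have /andP[l1 l2] : (1 - e) * v x <= u x <= (1 + e) * v x by near: x.
have a1 : 1 - e <= u x / v x by rewrite ler_pdivlMr.
have a2 : u x / v x <= 1 + e by rewrite ler_pdivrMr.
by rewrite ler_norml; apply/andP; split; lra.
Unshelve. all: by end_near. Qed.

(** * Asymptotics of the stopped sum and of its maximum *)

Theorem theorem7 (R : realType) (d : measure_display) (T : measurableType d)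
    (P : probability T R)
    (xi : {RV P >-> R}) (X : nat -> {RV P >-> R}) (tau : {RV P >-> nat}) :
  let F : probability R R := distribution P xi in
  let tauR : {RV P >-> R} := @nat_to_real R \o tau in
  let G : probability R R := distribution P tauR in
  mutually_independent X ->
  (forall n, same_law (X n) xi) ->
  (xi : T -> R) \in Lfun P 1%E ->
  (0 < 'E_P[xi])%E ->
  class_Sstar F ->
  ('E_P[tauR] < +oo)%E ->
  independent_of_sequence tau X ->
  tail F =O_ (pinfty_filter R) tail G ->
  intermediate_regularly_varying G ->
  asymp_equiv
    (fun x => fine (P [set w | x < partial_sum X (tau w) w]))
    (fun x => fine (P [set w | x < partial_max X (tau w) w])) /\
  asymp_equiv
    (fun x => fine (P [set w | x < partial_max X (tau w) w]))
    (fun x => fine 'E_P[tauR] * tail F x + tail G (x / fine 'E_P[xi])).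
Proof.
move=> F tauR G indep same xiL xi_gt0 Sstar tau_mean tau_indep FG irv.
have Fint : F.-integrable [set: R] (EFin : R -> \bar R) by case: Sstar.
have XF n B : measurable B -> P (X n @^-1` B) = F B by exact: same.
have meanE : fine 'E_P[xi] = \int[F]_y y.
  rewrite expectation_def /Rintegral; congr fine; rewrite integral_distribution//.
  by move: xiL; rewrite inE => /Lfun1_integrable.
have mu_gt0 : 0 < \int[F]_y y.
  by rewrite -meanE -lte_fin fineK//; exact: expectation_fin_num.
have [C FC] : exists C, \forall x \near +oo, tail F x <= C * tail G x.
  move: FG => /eqO_exP[C C0 HC]; exists C; apply: filterS HC => x.
  by rewrite !ger0_norm ?tail_ge0.
have flong := Sstar_long_tailed Sstar.
pose D := target F tau.
have D_gt0 x : 0 < D x.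
  have g0 : 0 < tail G (x / \int[F]_y y) by have [] := irv.
  apply: lt_le_trans g0 _; rewrite /D /target lerDr mulr_ge0 ?tail_ge0//.
  by have := partial_mean_le tau_mean 0; rewrite big_nil.
pose S x := fine (P [set w | x < partial_sum X (tau w) w]).
pose M x := fine (P [set w | x < partial_max X (tau w) w]).
have SE x : S x = pr P (at_index tau (fun n => [set w | x < partial_sum X n w])) by [].
have ME x : M x = pr P (at_index tau (fun n => crossed X n x)).
  rewrite /M /pr; congr (fine (P _)); apply/seteqP; split => w;
    by rewrite /at_index /= -partial_max_gt.
have SM x : S x <= M x.
  rewrite SE ME; apply: pr_le.
  - by apply: measurable_at_index => n; apply: past_gt; exact: past_partial_sum.
  - by apply: measurable_at_index => n; exact: past_crossed.
  - by move=> w Sw; exists (tau w).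
have upper := max_at_index_upper indep XF Fint mu_gt0 tau_mean tau_indep irv FC flong.
have lower := sum_at_index_lower indep XF Fint mu_gt0 tau_mean tau_indep irv FC flong.
have bounds (e : R) : 0 < e -> e <= 1 -> \forall x \near +oo,
    (1 - e) * D x <= S x /\ M x <= (1 + e) * D x.
  move=> e0 e1; have d0 : 0 < e / 3 by lra.
  have d1 : e / 3 < 1 by lra.
  have U := upper (e / 3) d0; have L := lower (e / 3) d0 d1.
  near=> x; rewrite SE ME; split.
    have -> : 1 - e = 1 - 3 * (e / 3) by field.
    by near: x.
  apply: (@le_trans _ _ ((1 + e / 3) * (1 + e / 3) * D x)); first by near: x.
  rewrite ler_wpM2r ?ltW//.
  have : e * e <= e * 1 by rewrite ler_wpM2l// ltW.
  by lra.
have bound_at (e : R) : 0 < e -> exists e', [/\ 0 < e', e' <= 1 & e' <= e / 4].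
  move=> e0; have [h|h] := leP 1 (e / 4).
    by exists 1; split; lra.
  by exists (e / 4); split; lra.
split; apply: asymp_equiv_of_sandwich.
- near=> x.
  have [l u] : (1 - 2^-1) * D x <= S x /\ M x <= (1 + 2^-1) * D x.
    by near: x; apply: bounds; lra.
  rewrite -/(M x) (lt_le_trans _ (SM x))// (lt_le_trans _ l)// mulr_gt0//; lra.
- move=> e e0; have [e' [e'0 e'1 e'e]] := bound_at e e0.
  have B := bounds e' e'0 e'1; near=> x.
  have [l u] : (1 - e') * D x <= S x /\ M x <= (1 + e') * D x by near: x.
  have Dx := D_gt0 x; have SMx := SM x.
  rewrite -/(S x) -/(M x).
  have M0 : 0 <= M x by rewrite ME pr_ge0.
  have S0 : 0 <= S x by rewrite SE pr_ge0.
  apply/andP; split; last first.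
    have : 0 <= e * M x by rewrite mulr_ge0// ltW.
    by lra.
  have [e1|e1] := leP 1 e.
    have : (1 - e) * M x <= 0 by rewrite mulr_le0_ge0//; lra.
    by lra.
  have : (1 - e) * M x <= (1 - e) * ((1 + e') * D x) by rewrite ler_wpM2l//; lra.
  have : e' * D x <= e / 4 * D x by rewrite ler_wpM2r// ltW.
  have : 0 <= e * e' * D x by rewrite !mulr_ge0// ltW.
  have : 0 <= e * D x by rewrite !mulr_ge0// ltW.
  by lra.
- by near=> x; rewrite meanE; exact: D_gt0.
- move=> e e0; have [e' [e'0 e'1 e'e]] := bound_at e e0.
  have B := bounds e' e'0 e'1; near=> x.
  have [l u] : (1 - e') * D x <= S x /\ M x <= (1 + e') * D x by near: x.
  have Dx := D_gt0 x; have SMx := SM x.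
  rewrite meanE; change ((1 - e) * D x <= M x <= (1 + e) * D x).
  have : e' * D x <= e / 4 * D x by rewrite ler_wpM2r// ltW.
  have : 0 <= e * D x by rewrite !mulr_ge0// ltW.
  by move=> h1 h2; apply/andP; split; lra.
Unshelve. all: by end_near. Qed.
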